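(* The variety of $4$-dimensional complex nilpotent terminal algebras has exactly $3$ irreducible components: one of dimension $17$, determined by the family of algebras $\mathbf D^4_{01}(\lambda,\alpha,\beta)$, $\lambda,\alpha,\beta\in\mathbb C$, and two of dimension $15$, determined by the families of algebras $\mathbf T^4_{41}(\alpha)$, $\alpha\in\mathbb C$, and $\mathbf T^4_{43}(\lambda,\alpha)$, $\lambda,\alpha\in\mathbb C$, respectively. Here the component determined by a family is the Zariski closure of the union of the $\mathrm{GL}_4(\mathbb C)$-orbits of the algebra structures in the family.
   Context: An algebra over $\mathbb C$ is a complex vector space with a bilinear product $xy$ (no associativity, commutativity or unit assumed). It is nilpotent if for some $k$ all products of $k$ elements, with any bracketing, vanish. Terminal algebra: for an element $a$ put $C_a(x,y)=a(xy)-(ax)y-x(ay)$. The algebra is terminal if for all $a,x,y,z$ $$C_a(xy,z)+C_a(x,yz)+C_a(y,xz)-C_a(x,y)z-x\,C_a(y,z)-y\,C_a(x,z)=0 .$$ The variety: let $\mathbf V$ be a $4$-dimensional complex vector space with fixed basis $e_1,\dots,e_4$. The space $\mathrm{Hom}(\mathbf V\otimes\mathbf V,\mathbf V)\cong\mathbb C^{64}$ of algebra structures (with structure constants as coordinates) carries the Zariski topology and the action $(g*\mu)(x\otimes y)=g\mu(g^{-1}x\otimes g^{-1}y)$ of $\mathrm{GL}(\mathbf V)$, whose orbits are the isomorphism classes. The variety of $4$-dimensional complex nilpotent terminal algebras is the Zariski-closed, $\mathrm{GL}(\mathbf V)$-stable subset of those $\mu$ for which $(\mathbf V,\mu)$ is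 nilpotent and terminal. An irreducible component is a maximal irreducible closed subset. The algebras (basis $e_1,\dots,e_4$, unlisted products of basis elements are zero): $\mathbf D^4_{01}(\lambda,\alpha,\beta)$: $e_1e_1=\lambda e_3+e_4,\ e_1e_3=\alpha e_4,\ e_2e_1=e_3,\ e_2e_2=e_3,\ e_2e_3=\beta e_4,\ e_3e_1=e_4$. $\mathbf T^4_{41}(\alpha)$: $e_1e_1=e_2,\ e_1e_2=\alpha e_4,\ e_1e_3=-e_4,\ e_2e_1=e_3,\ e_2e_3=e_4,\ e_3e_1=3e_4$. $\mathbf T^4_{43}(\lambda,\alpha)$: $e_1e_1=e_2,\ e_1e_2=\lambda e_3,\ e_1e_3=(\alpha(\lambda-1)+1)e_4,\ e_2e_1=e_3,\ e_2e_2=e_4,\ e_3e_1=3\alpha e_4$. *)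

(* Defs.v *)
From mathcomp Require Import all_boot all_order all_algebra.
From mathcomp Require Import classical_sets reals complex.
From mathcomp Require Import mpoly.

Set Implicit Arguments.
Unset Strict Implicit.
Unset Printing Implicit Defensive.

Import GRing.Theory.

Local Open Scope ring_scope.
Local Open Scope classical_set_scope.

Section Zariski.
Variables (K : fieldType) (I : finType).

(* Affine space K^I.  Multivariate polynomials have variables indexed by an
   ordinal, so the coordinates are numbered by the enumeration of I. *)
Definition affine := {ffun I -> K}.

Definition peval (p : {mpoly K[#|I|]}) (x : affine) : K :=
  p.@[fun k => x (enum_val k)].

Definition zero_locus (S : set {mpoly K[#|I|]}) : set affine :=
  [set x | forall p, S p -> peval p x = 0].

Definition zariski_closed (Z : set affine) : Prop :=
  exists S, Z = zero_locus S.

Definition zariski_closure (A : set affine) : set affine :=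
  smallest zariski_closed A.

Definition zariski_irreducible (Z : set affine) : Prop :=
  Z !=set0 /\
  forall A B, zariski_closed A -> zariski_closed B ->
    Z `<=` A `|` B -> Z `<=` A \/ Z `<=` B.

Definition irreducible_closed_in (X Z : set affine) : Prop :=
  [/\ zariski_closed Z, zariski_irreducible Z & Z `<=` X].

Definition irreducible_component (X Z : set affine) : Prop :=
  irreducible_closed_in X Z /\
  forall Y, irreducible_closed_in X Y -> Z `<=` Y -> Y = Z.

(* A strictly increasing chain F 0 < F 1 < ... < F m (of length m) of
   irreducible closed subsets of Z; values of F beyond m are irrelevant. *)
Definition irreducible_chain (Z : set affine) (m : nat) : Prop :=
  exists F : nat -> set affine,
    (forall i, (i <= m)%N -> irreducible_closed_in Z (F i)) /\
    (forall i, (i < m)%N -> F i `<` F i.+1).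

(* Krull dimension of Z as a topological space. *)
Definition has_dimension (Z : set affine) (d : nat) : Prop :=
  irreducible_chain Z d /\
  forall m, irreducible_chain Z m -> (m <= d)%N.

End Zariski.

Section Algebras.
Variables (K : fieldType) (n : nat).

(* mu (i, j, k) is the coefficient of e_k in the product e_i e_j, the indices
   starting at 0. *)
Definition algebra_structure := affine K ('I_n * 'I_n * 'I_n)%type.

Implicit Types mu nu : algebra_structure.

Definition amul mu (x y : 'cV[K]_n) : 'cV[K]_n :=
  \col_k \sum_i \sum_j mu (i, j, k) * x i 0 * y j 0.

Definition structure_of (m : 'I_n -> 'I_n -> 'cV[K]_n) : algebra_structure :=
  [ffun t => m t.1.1 t.1.2 t.2 0].

(* x is a product of k elements under some bracketing. *)
Inductive product_of mu : nat -> 'cV[K]_n -> Prop :=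
| product_one x : product_of mu 1 x
| product_mul k l x y :
    product_of mu k x -> product_of mu l y ->
    product_of mu (k + l) (amul mu x y).

(* k > 0 is needed: there is no product of 0 elements. *)
Definition nilpotent_algebra mu : Prop :=
  exists2 k, (0 < k)%N & forall x, product_of mu k x -> x = 0.

Definition terminal_defect mu (a x y : 'cV[K]_n) : 'cV[K]_n :=
  amul mu a (amul mu x y) - amul mu (amul mu a x) y - amul mu x (amul mu a y).

Definition terminal_algebra mu : Prop :=
  forall a x y z,
    terminal_defect mu a (amul mu x y) z
    + terminal_defect mu a x (amul mu y z)
    + terminal_defect mu a y (amul mu x z)
    - amul mu (terminal_defect mu a x y) z
    - amul mu x (terminal_defect mu a y z)
    - amul mu y (terminal_defect mu a x z) = 0.

Definition nilpotent_terminal : set algebra_structure :=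
  [set mu | nilpotent_algebra mu /\ terminal_algebra mu].

Definition gl_act (g : 'M[K]_n) mu : algebra_structure :=
  structure_of (fun i j =>
    g *m amul mu (invmx g *m delta_mx i 0) (invmx g *m delta_mx j 0)).

Definition gl_orbit mu : set algebra_structure :=
  [set nu | exists2 g, g \in unitmx & nu = gl_act g mu].

Definition family_closure (F : set algebra_structure) : set algebra_structure :=
  zariski_closure (\bigcup_(mu in F) gl_orbit mu).

End Algebras.

Section Families.
Variable K : fieldType.

Definition e (k : nat) : 'cV[K]_4 := delta_mx (inord k.-1) 0.

(* m i j is the product e_i e_j, with the indices i and j in 1, 2, 3, 4. *)
Definition table4 (m : nat -> nat -> 'cV[K]_4) : algebra_structure K 4 :=
  structure_of (fun i j : 'I_4 => m i.+1 j.+1).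

Definition D01 (lambda alpha beta : K) : algebra_structure K 4 :=
  table4 (fun i j => match i, j with
    | 1%N, 1%N => lambda *: e 3 + e 4
    | 1%N, 3%N => alpha *: e 4
    | 2%N, 1%N => e 3
    | 2%N, 2%N => e 3
    | 2%N, 3%N => beta *: e 4
    | 3%N, 1%N => e 4
    | _, _ => 0
    end).

Definition T41 (alpha : K) : algebra_structure K 4 :=
  table4 (fun i j => match i, j with
    | 1%N, 1%N => e 2
    | 1%N, 2%N => alpha *: e 4
    | 1%N, 3%N => - e 4
    | 2%N, 1%N => e 3
    | 2%N, 3%N => e 4
    | 3%N, 1%N => 3%:R *: e 4
    | _, _ => 0
    end).

Definition T43 (lambda alpha : K) : algebra_structure K 4 :=
  table4 (fun i j => match i, j with
    | 1%N, 1%N => e 2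
    | 1%N, 2%N => lambda *: e 3
    | 1%N, 3%N => (alpha * (lambda - 1) + 1) *: e 4
    | 2%N, 1%N => e 3
    | 2%N, 2%N => e 4
    | 3%N, 1%N => (3%:R * alpha) *: e 4
    | _, _ => 0
    end).

Definition D01_family : set (algebra_structure K 4) :=
  [set mu | exists lambda alpha beta, mu = D01 lambda alpha beta].

Definition T41_family : set (algebra_structure K 4) :=
  [set mu | exists alpha, mu = T41 alpha].

Definition T43_family : set (algebra_structure K 4) :=
  [set mu | exists lambda alpha, mu = T43 lambda alpha].

End Families.

Arguments nilpotent_terminal : clear implicits.
Arguments D01_family : clear implicits.
Arguments T41_family : clear implicits.
Arguments T43_family : clear implicits.

(* Main.v *)
Require Import Defs.
From mathcomp Require Import all_boot all_order all_algebra.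
From mathcomp Require Import boolp classical_sets reals complex.
From mathcomp Require Import mpoly ring zify.

(* A nilpotent algebra of dimension 4 has a basis in which e_i e_j lies in the
   span of the e_k with k > max(i, j), hence 14 structure constants.  In such a
   basis the terminal identity leaves three possibilities, up to a change of
   basis: a 12-dimensional linear space of algebras with A A in a plane P and
   A P, P A in a line (when e1e1 has no e2-component or e1(e1e1), (e1e1)e1 lie
   in the span of e4), and two families with e1e1 = c e2 + ... and either
   e1(e1e1) in the span of e4 or e2e3 = 0.  The generic members of these three
   sets are isomorphic to members of the families D01, T41 and T43, and
   polynomial curves carry the generic case to closures.

   Moving the flag by a unipotent matrix gives dominant polynomial maps from
   affine spaces of dimension 17, 15, 15 to the closures.  These make the
   closures irreducible and bound chains of irreducible closed sets: along a
   chain of length m one collects m algebraically independent functions, and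
   there are at most as many as parameters.  Conversely, switching on the
   parameters one at a time yields chains of length 17, 15, 15.  The components
   are told apart by the identities ((xy)z)t = 0 (on the closure of D01),
   (xy)((zt)u) = 0 (on that of T43) and (x(yz))t = 0 (on that of T41), and by
   dimension. *)

Set Implicit Arguments.
Unset Strict Implicit.
Unset Printing Implicit Defensive.

Import Order.TTheory GRing.Theory Num.Theory.

Local Open Scope ring_scope.
Local Open Scope classical_set_scope.

(** * Polynomial functions and Zariski closed sets *)

Section PolynomialFunctions.
Variable K : numFieldType.
Implicit Types I J : finType.

(** The dimensions are 17 = 12 + 5 and 15 = 9 + 6: the free structure constants plus the dimension
    of the variety of flags relative to which they are written, a line in a plane in the first case
    and full flags of K^4 in the other two. Neither nilpotency nor base change is polynomial as it
    stands. The exponent of nilpotency is existential, so closures are controlled through the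
    vanishing of all products by four successive one-sided factors, which holds on triangular
    algebras. The inverse in [gl_act] is traded for the adjugate, at the cost of a scalar that a
    seventh root absorbs. Algebraic closedness enters there and in the choice of an isotropic
    vector; characteristic zero makes the field infinite and permits division by 2 and 3. To prove
    the parametrizations dense, each set of triangular algebras has to be recognised again after a
    base change about which only the preserved flag is known. Hence their second description,
    through flags instead of coordinates. *)

Inductive pfun I : (affine K I -> K) -> Prop :=
| pfun_const c : pfun (fun=> c)
| pfun_coord i : pfun (fun x => x i)
| pfun_add f g : pfun f -> pfun g -> pfun (fun x => f x + g x)
| pfun_mul f g : pfun f -> pfun g -> pfun (fun x => f x * g x).

Definition polymap I J (phi : affine K I -> affine K J) :=
  forall j, pfun (fun x => phi x j).

Lemma pfun_opp I (f : affine K I -> K) : pfun f -> pfun (fun x => - f x).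
Proof.
move=> pf; under eq_fun do rewrite -mulN1r.
by apply: pfun_mul => //; apply: pfun_const.
Qed.

Lemma pfun_sub I (f g : affine K I -> K) :
  pfun f -> pfun g -> pfun (fun x => f x - g x).
Proof. by move=> pf pg; apply: pfun_add => //; apply: pfun_opp. Qed.

Lemma pfun_sum I T (r : seq T) (P : pred T) (F : T -> affine K I -> K) :
  (forall t, pfun (F t)) -> pfun (fun x => \sum_(t <- r | P t) F t x).
Proof.
move=> pF; elim: r => [|t r IHr].
  by under eq_fun do rewrite big_nil; apply: pfun_const.
under eq_fun do rewrite big_cons.
by case: (P t) => //; apply: pfun_add.
Qed.

Lemma pfun_prod I T (r : seq T) (P : pred T) (F : T -> affine K I -> K) :
  (forall t, pfun (F t)) -> pfun (fun x => \prod_(t <- r | P t) F t x).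
Proof.
move=> pF; elim: r => [|t r IHr].
  by under eq_fun do rewrite big_nil; apply: pfun_const.
under eq_fun do rewrite big_cons.
by case: (P t) => //; apply: pfun_mul.
Qed.

Lemma pfun_exp I (f : affine K I -> K) n : pfun f -> pfun (fun x => f x ^+ n).
Proof.
move=> pf; elim: n => [|n IHn]; first by apply: pfun_const.
by under eq_fun do rewrite exprS; apply: pfun_mul.
Qed.

Lemma pfun_comp I J (f : affine K J -> K) (phi : affine K I -> affine K J) :
  pfun f -> polymap phi -> pfun (fun x => f (phi x)).
Proof.
move=> pf pphi; elim: pf => [c|i|g h _ IHg _ IHh|g h _ IHg _ IHh].
- exact: pfun_const.
- exact: pphi.
- exact: pfun_add.
- exact: pfun_mul.
Qed.

(** Links the inductive predicate, on which composition and restriction to a line are plain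
    inductions, to [peval], which numbers the variables through [enum_val]. *)
Lemma pfunP I (f : affine K I -> K) : pfun f <-> exists p, f = peval p.
Proof.
split=> [|[p ->]].
  elim=> [c|i|g h _ [p ->] _ [q ->]|g h _ [p ->] _ [q ->]].
  - by exists c%:MP; apply/funext => x; rewrite /peval mevalC.
  - exists 'X_(enum_rank i); apply/funext => x.
    by rewrite /peval mevalXU enum_rankK.
  - by exists (p + q); apply/funext => x; rewrite /peval mevalD.
  - by exists (p * q); apply/funext => x; rewrite /peval mevalM.
rewrite /peval; under eq_fun do rewrite mevalE.
apply: pfun_sum => m; apply: pfun_mul; first exact: pfun_const.
by apply: pfun_prod => k; apply: pfun_exp; apply: pfun_coord.
Qed.

Definition line I (x y : affine K I) (s : K) : affine K I :=
  [ffun i => x i + s * (y i - x i)].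

Lemma line0 I (x y : affine K I) : line x y 0 = x.
Proof. by apply/ffunP => i; rewrite ffunE mul0r addr0. Qed.

Lemma line1 I (x y : affine K I) : line x y 1 = y.
Proof. by apply/ffunP => i; rewrite ffunE mul1r addrC subrK. Qed.

Lemma pfun_line I (f : affine K I -> K) x y :
  pfun f -> exists p : {poly K}, forall s, f (line x y s) = p.[s].
Proof.
elim=> [c|i|g h _ [p Ep] _ [q Eq]|g h _ [p Ep] _ [q Eq]].
- by exists c%:P => s; rewrite hornerC.
- exists ((x i)%:P + 'X * (y i - x i)%:P) => s.
  by rewrite ffunE !hornerE.
- by exists (p + q) => s; rewrite hornerD Ep Eq.
- by exists (p * q) => s; rewrite hornerM Ep Eq.
Qed.

Lemma poly_eq0_horner (p : {poly K}) : (forall s, p.[s] = 0) -> p = 0.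
Proof.
move=> p0; apply: (@roots_geq_poly_eq0 _ _ [seq n%:R | n <- iota 0 (size p)]).
- by apply/allP => _ /mapP[n _ ->]; apply/rootP.
- by rewrite map_inj_uniq ?iota_uniq // => m n /eqP; rewrite eqr_nat => /eqP.
- by rewrite size_map size_iota.
Qed.

(** Restriction to the line through a point where f is nonzero and an arbitrary point y reduces the
    claim to polynomials in one variable over an infinite field. *)
Lemma pfun_integral I (f g : affine K I -> K) : pfun f -> pfun g ->
  (forall x, f x * g x = 0) -> (forall x, f x = 0) \/ (forall x, g x = 0).
Proof.
move=> pf pg fg0; have [f0|/existsNP[x fx]] := pselect (forall x, f x = 0).
  by left.
right=> y; have [p Ep] := pfun_line x y pf; have [q Eq] := pfun_line x y pg.
have /eqP: p * q = 0 by apply: poly_eq0_horner => s; rewrite hornerM -Ep -Eq.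
rewrite mulf_eq0 => /orP[]/eqP E.
  by case: fx; rewrite -(line0 x y) Ep E horner0.
by rewrite -(line1 x y) Eq E horner0.
Qed.

End PolynomialFunctions.

Ltac pfun_step := first [ exact: pfun_const | exact: pfun_coord | assumption
  | apply: pfun_sub | apply: pfun_opp | apply: pfun_add | apply: pfun_mul
  | apply: pfun_exp ].
Ltac solve_pfun := repeat pfun_step.

(** * The Zariski topology expressed by polynomial functions *)

Section ZariskiTopology.
Variable K : numFieldType.
Implicit Types I J : finType.

Lemma zariski_closedP I (Z : set (affine K I)) : zariski_closed Z <->
  forall x, (forall f, pfun f -> (forall y, Z y -> f y = 0) -> f x = 0) -> Z x.
Proof.
split=> [[S ->] x Zx p Sp|clZ].
  by apply: Zx => [|y]; [apply/pfunP; exists p|apply].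
exists [set p | forall y, Z y -> peval p y = 0].
apply/seteqP; split=> [x Zx p|x /= Zx]; first by apply.
by apply: clZ => f /pfunP[p ->]; apply: Zx.
Qed.

Lemma zariski_closureP I (A : set (affine K I)) x : zariski_closure A x <->
  forall f, pfun f -> (forall y, A y -> f y = 0) -> f x = 0.
Proof.
split=> [Ax f pf fA|Ax B [/zariski_closedP clB AB]].
  apply: (Ax [set y | f y = 0]); split=> //.
  by apply/zariski_closedP => y; apply.
by apply: clB => f pf fB; apply: Ax => // y /AB; apply: fB.
Qed.

Lemma zariski_closure_closed I (A : set (affine K I)) :
  zariski_closed (zariski_closure A).
Proof.
apply/zariski_closedP => x Ax; apply/zariski_closureP => f pf fA.
by apply: Ax => // y /zariski_closureP; apply.
Qed.

Lemma subset_zariski_closure I (A : set (affine K I)) :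
  A `<=` zariski_closure A.
Proof. by move=> x Ax; apply/zariski_closureP => f _; apply. Qed.

Lemma zariski_closure_sub I (A Z : set (affine K I)) :
  zariski_closed Z -> A `<=` Z -> zariski_closure A `<=` Z.
Proof. by move=> clZ AZ x; apply. Qed.

Lemma zariski_closed_zero I (f : affine K I -> K) :
  pfun f -> zariski_closed [set x | f x = 0].
Proof. by move=> pf; apply/zariski_closedP => x; apply. Qed.

Lemma zariski_closed_all I T (Z : T -> set (affine K I)) :
  (forall t, zariski_closed (Z t)) -> zariski_closed [set x | forall t, Z t x].
Proof.
move=> clZ; apply/zariski_closedP => x Zx t.
have /zariski_closedP := clZ t; apply=> f pf fZ.
by apply: Zx => // y; move/(_ t); apply: fZ.
Qed.

Lemma zariski_closed_and I (Y Z : set (affine K I)) :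
  zariski_closed Y -> zariski_closed Z -> zariski_closed [set x | Y x /\ Z x].
Proof.
move=> /zariski_closedP clY /zariski_closedP clZ.
apply/zariski_closedP => x YZx.
by split; [apply: clY|apply: clZ] => f pf fYZ; apply: YZx => // y [Yy Zy];
  apply: fYZ.
Qed.

Lemma zariski_closed_separate I (Z : set (affine K I)) x :
  zariski_closed Z -> ~ Z x ->
  exists f, [/\ pfun f, forall y, Z y -> f y = 0 & f x <> 0].
Proof.
move=> /zariski_closedP clZ nZx; apply: contrapT => H; apply: nZx.
by apply: clZ => f pf fZ; apply: contrapT => fx; apply: H; exists f.
Qed.

Lemma zariski_closed_or I (Y Z : set (affine K I)) :
  zariski_closed Y -> zariski_closed Z -> zariski_closed (Y `|` Z).
Proof.
move=> clY clZ; apply/zariski_closedP => x YZx.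
have [Yx|/(zariski_closed_separate clY)[f [pf fY fx]]] := pselect (Y x).
  by left.
have [Zx|/(zariski_closed_separate clZ)[g [pg gZ gx]]] := pselect (Z x).
  by right.
have /eqP : f x * g x = 0.
  apply: (YZx (fun y => f y * g y)) => [|y]; first exact: pfun_mul.
  by case=> [/fY|/gZ] ->; rewrite ?mul0r ?mulr0.
by rewrite mulf_eq0 => /orP[]/eqP.
Qed.

Lemma zariski_closed_preimage I J (phi : affine K I -> affine K J)
    (Z : set (affine K J)) :
  polymap phi -> zariski_closed Z -> zariski_closed [set x | Z (phi x)].
Proof.
move=> pphi /zariski_closedP clZ; apply/zariski_closedP => x Zx.
apply: clZ => f pf fZ; apply: (Zx (fun y => f (phi y))) => [|y /fZ//].
exact: pfun_comp.
Qed.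

(** Equations of A and B that fail at two points of the range pull back to nonzero functions on
    affine space, whose product cannot vanish identically. *)
Lemma closure_range_irreducible I J (phi : affine K I -> affine K J) :
  polymap phi -> zariski_irreducible (zariski_closure (range phi)).
Proof.
move=> pphi; split.
  by exists (phi [ffun=> 0]); apply: subset_zariski_closure; exists [ffun=> 0].
move=> A B clA clB AB.
have [sA|/existsNP[x /not_implyP[[s _ <-] nA]]] :=
  pselect (range phi `<=` A); first by left; apply: zariski_closure_sub.
have [sB|/existsNP[y /not_implyP[[t _ <-] nB]]] :=
  pselect (range phi `<=` B); first by right; apply: zariski_closure_sub.
have [f [pf fA fs]] := zariski_closed_separate clA nA.
have [g [pg gB gt]] := zariski_closed_separate clB nB.
have := pfun_integral (pfun_comp pf pphi) (pfun_comp pg pphi).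
case=> [u|/(_ s)//|/(_ t)//].
have /AB[/fA->|/gB->] : zariski_closure (range phi) (phi u).
- by apply: subset_zariski_closure; exists u.
- by rewrite mul0r.
- by rewrite mulr0.
Qed.

(** The locus q <> 0 is dense as soon as it contains one point [t0]. This is how normal forms that
    require nonzero denominators reach all parameter values. *)
Lemma closed_of_generic I J (phi : affine K I -> affine K J)
    (q : affine K I -> K) (t0 : affine K I) (Z : set (affine K J)) :
  polymap phi -> pfun q -> q t0 != 0 -> zariski_closed Z ->
  (forall t, q t != 0 -> Z (phi t)) -> forall t, Z (phi t).
Proof.
move=> pphi pq q0 /zariski_closedP clZ Zq t; apply: clZ => f pf fZ.
have [s|/(_ t0)/eqP|//] := pfun_integral pq (pfun_comp pf pphi).
  have [->|/Zq/fZ->] := eqVneq (q s) 0; first by rewrite mul0r.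
  by rewrite mulr0.
by rewrite (negbTE q0).
Qed.

End ZariskiTopology.

(** * Dimension of unirational varieties *)

Section Dimension.
Variable K : numFieldType.
Implicit Types I J : finType.

(** [msize] is the degree plus one; the bound is coarse because only its linear growth in the number
    of factors matters. *)
Lemma msize_prod_le n T (r : seq T) (P : pred T) (F : T -> {mpoly K[n]}) d :
  (forall t, (msize (F t) <= d)%N) ->
  (msize (\prod_(t <- r | P t) F t) <= size r * d.+1 + 1)%N.
Proof.
move=> Fd; elim: r => [|t r IHr]; first by rewrite big_nil msize1.
rewrite big_cons [size _]/= mulSn -addnA; case: (P t).
  by apply: leq_trans (msizeM_le _ _) _; rewrite addSn ltnS leq_add.
by apply: leq_trans IHr (leq_addl _ _).
Qed.

Lemma kernel_vector m n (A : 'M[K]_(m, n)) :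
  (n < m)%N -> exists2 v : 'rV_m, v != 0 & v *m A = 0.
Proof.
move=> nm; have : kermx A != 0.
  rewrite -mxrank_eq0 mxrank_ker -lt0n subn_gt0.
  exact: leq_ltn_trans (rank_leq_col A) nm.
by case/rowV0Pn=> v /sub_kermxP vA nz; exists v.
Qed.

(** Algebraic independence of the restrictions to Z of the components of f: over an infinite field a
    relation G that vanishes everywhere is the zero polynomial. *)
Definition poly_independent I J (Z : set (affine K I))
    (f : affine K I -> affine K J) :=
  forall G, pfun G -> (forall x, Z x -> G (f x) = 0) -> forall y, G y = 0.

(* The polynomials in the coordinates y_j vanishing at all but one point of
   the grid {0, ..., N-1}^J have degree linear in N, whence a linear relation
   between their pullbacks when N is large and I is smaller than J. *)
Lemma dominant_card I J (f : affine K I -> affine K J) :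
  polymap f -> poly_independent setT f -> (#|J| <= #|I|)%N.
Proof.
move=> pf indep; rewrite leqNgt; apply/negP => ltIJ.
have /choice[p Ep] j : exists p, (fun x => f x j) = peval p by apply/pfunP.
set n := #|I| in p Ep ltIJ *.
pose d := \max_j maxn (msize (p j)) 1.
pose E := (#|J| * d.+1 + 1)%N.
(* N is chosen so that the exponent vectors with entries below D, at most (N E)^n = N^n E^n of them,
   are fewer than N^(n+1), hence fewer than the grid points. *)
pose N := (E ^ n).+1.
pose D := (#|J| * N * d.+1 + 1)%N.
pose P (b : {ffun J -> 'I_N}) : {mpoly K[n]} :=
  \prod_(u : J * 'I_N | u.2 != b u.1) (p u.1 - (u.2%:R)%:MP).
have msP b : (msize (P b) <= D)%N.
  rewrite /D -[N]card_ord -card_prod cardE enumT.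
  apply: msize_prod_le => u; apply: leq_trans (msizeD_le _ _) _.
  rewrite msizeN msizeC; apply: leq_trans (leq_bigmax u.1).
  rewrite geq_max leq_maxl /=; apply: leq_trans (leq_maxr _ _).
  by case: eqP.
have cardlt : (#|{ffun 'I_n -> 'I_D}| < #|{ffun J -> 'I_N}|)%N.
  rewrite !card_ffun !card_ord.
  have DN : (D <= N * E)%N by rewrite /D /E mulnDr; lia.
  apply: (@leq_ltn_trans ((N * E) ^ n)); first by case: (n) => // n'; rewrite leq_exp2r.
  rewrite expnMn; apply: (@leq_trans (N ^ n.+1)).
    by rewrite expnS mulnC ltn_mul2r expn_gt0 /= /N ltnSn.
  by rewrite leq_pexp2l.
(* The rows are the coefficient vectors of the [P b]; with more rows than columns they satisfy a
   linear relation. *)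
pose A := \matrix_(k < #|{ffun J -> 'I_N}|, l < #|{ffun 'I_n -> 'I_D}|)
  (P (enum_val k))@_[multinom (enum_val l i : nat) | i < n].
have [v nz_v vA] := kernel_vector A cardlt.
pose Q := \sum_k v 0 k *: P (enum_val k).
have Q0 : Q = 0.
  apply/mpolyP => m; rewrite mcoeff0.
  have [mD|Dm] := ltnP (mdeg m) D; last first.
    rewrite raddf_sum big1 //= => k _; rewrite mcoeffZ.
    have /memN_msupp_eq0-> : m \notin msupp (P (enum_val k)).
      by apply: msize_mdeg_ge; apply: leq_trans (msP _) Dm.
    by rewrite mulr0.
  have mi i : (m i < D)%N.
    by apply: leq_ltn_trans mD; rewrite mdegE (bigD1 i) //= leq_addr.
  pose b : {ffun 'I_n -> 'I_D} := [ffun i => Ordinal (mi i)].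
  have /rowP/(_ (enum_rank b)) := vA; rewrite !mxE => <-.
  rewrite raddf_sum /=; apply: eq_bigr => k _; rewrite mcoeffZ !mxE enum_rankK.
  by congr (_ * _@_ _); apply/mnmP => i; rewrite mnmE ffunE.
pose delta (b : {ffun J -> 'I_N}) (y : affine K J) : K :=
  \prod_(u : J * 'I_N | u.2 != b u.1) (y u.1 - u.2%:R).
pose G y := \sum_k v 0 k * delta (enum_val k) y.
have pG : pfun G.
  apply: pfun_sum => k; apply: pfun_mul; first exact: pfun_const.
  by apply: pfun_prod => u; solve_pfun.
have G0 : forall y, G y = 0.
  apply: (indep) pG _ => x _.
  transitivity (peval Q x); last by rewrite Q0 /peval meval0.
  rewrite /peval /Q raddf_sum /=; apply: eq_bigr => k _; rewrite mevalZ.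
  congr (_ * _); rewrite /delta /P rmorph_prod /=; apply: eq_bigr => u _.
  by rewrite mevalB mevalC -[f x u.1]/((fun x => f x u.1) x) Ep.
case/eqP: nz_v; apply/rowP => k; rewrite mxE.
(* At a grid point every [delta] but its own has a vanishing factor, so the value of G there is one
   coefficient of the relation times a nonzero number. *)
have /eqP := G0 [ffun j => (enum_val k j)%:R].
rewrite /G (bigD1 k) //= big1 => [|l lk]; last first.
  suff -> : delta (enum_val l) [ffun j => (enum_val k j)%:R] = 0.
    by rewrite mulr0.
  have /existsP[j nj] : [exists j, enum_val k j != enum_val l j].
    rewrite -negb_forall; apply: contra lk => /forallP E'.
    by apply/eqP/enum_val_inj/ffunP => j; apply/esym/eqP.
  by rewrite /delta (bigD1 (j, enum_val k j)) //= ffunE subrr mul0r.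
rewrite addr0 mulf_eq0 => /orP[/eqP//|].
rewrite prodf_seq_eq0 => /hasP[u _ /andP[/= nu]].
by rewrite ffunE subr_eq0 eqr_nat eq_sym (inj_eq val_inj) (negbTE nu).
Qed.

Definition optcons J (s : K) (y : affine K J) : affine K (option J) :=
  [ffun o => if o is Some j then y j else s].

(** The coordinate [None] becomes the variable of a polynomial in one variable; the degree bound N,
    uniform in y, later keeps a sum over its coefficients finite. *)
Lemma pfun_optcons J (G : affine K (option J) -> K) : pfun G ->
  exists (P : affine K J -> {poly K}) (N : nat),
    [/\ forall y, (size (P y) <= N)%N, forall k, pfun (fun y => (P y)`_k)
      & forall s y, G (optcons s y) = (P y).[s]].
Proof.
elim=> [c|[j|]|f g _ [P [M [sP pP EP]]] _ [Q [N [sQ pQ EQ]]]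
  |f g _ [P [M [sP pP EP]]] _ [Q [N [sQ pQ EQ]]]].
- exists (fun=> c%:P), 1%N; split=> [y|k|s y].
  + by rewrite size_polyC leq_b1.
  + exact: pfun_const.
  + by rewrite hornerC.
- exists (fun y => (y j)%:P), 1%N; split=> [y|k|s y].
  + by rewrite size_polyC leq_b1.
  + under eq_fun do rewrite coefC.
    by case: eqP => _; solve_pfun.
  + by rewrite hornerC ffunE.
- exists (fun=> 'X), 2; split=> [y|k|s y].
  + by rewrite size_polyX.
  + exact: pfun_const.
  + by rewrite hornerX ffunE.
- exists (fun y => P y + Q y), (maxn M N); split=> [y|k|s y].
  + apply: leq_trans (size_polyD _ _) _.
    by rewrite geq_max !leq_max sP sQ orbT.
  + under eq_fun do rewrite coefD.
    exact: pfun_add.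
  + by rewrite hornerD EP EQ.
- exists (fun y => P y * Q y), (M + N)%N; split=> [y|k|s y].
  + apply: leq_trans (size_polyMleq _ _) _.
    by apply: leq_trans (leq_pred _) _; rewrite leq_add.
  + under eq_fun do rewrite coefM.
    by apply: pfun_sum => i; apply: pfun_mul.
  + by rewrite hornerM EP EQ.
Qed.

Lemma irreducible_integral I (Z : set (affine K I)) f g :
  zariski_irreducible Z -> pfun f -> pfun g ->
  (forall x, Z x -> f x * g x = 0) ->
  (forall x, Z x -> f x = 0) \/ (forall x, Z x -> g x = 0).
Proof.
move=> [_ irrZ] pf pg fg0.
apply: irrZ (zariski_closed_zero pf) (zariski_closed_zero pg) _ => x Zx.
have /eqP := fg0 x Zx; rewrite mulf_eq0 => /orP[]/eqP; first by left.
by right.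
Qed.

(* A polynomial vanishing on Y but not on Z is transcendental over functions
   independent on Y: the lowest coefficient of a relation vanishes on Y. *)
Lemma poly_independent_optcons I J (Y Z : set (affine K I))
    (f : affine K I -> affine K J) (h : affine K I -> K) :
  zariski_irreducible Z -> Y `<=` Z -> polymap f -> pfun h ->
  (forall x, Y x -> h x = 0) -> (exists2 x, Z x & h x <> 0) ->
  poly_independent Y f -> poly_independent Z (fun x => optcons (h x) (f x)).
Proof.
move=> irrZ YZ pf ph h0 [z Zz hz] indep G pG G0.
have [P [N [sP pP EP]]] := pfun_optcons pG.
have P0 k : forall y, (P y)`_k = 0.
  elim/ltn_ind: k => k IHk.
  (* Once the coefficients below k vanish, s^k factors out. The cofactor H vanishes on the
     irreducible Z, where h is not identically zero, and on Y, where h = 0, it reduces to the k-th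
     coefficient. *)
  pose H s y := \sum_(j < N) (P y)`_(k + j) * s ^+ j.
  have EH s y : (P y).[s] = s ^+ k * H s y.
    rewrite (horner_coef_wide s (leq_trans (sP y) (leq_addl k N))).
    rewrite big_split_ord /= big1 ?add0r => [|j _]; last first.
      by rewrite IHk ?mul0r.
    rewrite /H mulr_sumr; apply: eq_bigr => j _.
    by rewrite exprD mulrCA.
  have pH : pfun (fun x => H (h x) (f x)).
    apply: pfun_sum => j; apply: pfun_mul; last exact: pfun_exp.
    exact: (pfun_comp (pP (k + j)%N)) pf.
  have HZ x : Z x -> H (h x) (f x) = 0.
    move: x; have := irreducible_integral irrZ (pfun_exp k ph) pH.
    case=> [x Zx|/(_ z Zz)/eqP|//]; first by rewrite -EH -EP G0.
    by rewrite expf_eq0 => /andP[_ /eqP].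
  apply: (indep (fun y => (P y)`_k)) => // x Yx.
  have := HZ x (YZ x Yx); rewrite h0 // /H.
  case: (N) (sP (f x)) => [|M] sPx.
    by move=> _; rewrite nth_default // (leq_trans sPx).
  rewrite big_ord_recl expr0 mulr1 addn0 big1 ?addr0 // => j _.
  by rewrite exprS mul0r mulr0.
move=> y; pose y' : affine K J := [ffun j => y (Some j)].
have -> : y = optcons (y None) y' by apply/ffunP => -[j|]; rewrite !ffunE.
by rewrite EP horner_coef big1 // => j _; rewrite P0 mul0r.
Qed.

(** Each strict inclusion supplies a function that vanishes on the smaller set only, and J grows by
    one [option]. For empty J, G is a constant, and a point of [F 0] shows that it is zero. *)
Lemma chain_independent I (Z : set (affine K I)) (F : nat -> set (affine K I))
    m :
  (forall i, (i <= m)%N -> irreducible_closed_in Z (F i)) ->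
  (forall i, (i < m)%N -> F i `<` F i.+1) ->
  forall i, (i <= m)%N -> exists (J : finType) (f : affine K I -> affine K J),
    [/\ #|J| = i, polymap f & poly_independent (F i) f].
Proof.
move=> FZ Flt; elim=> [|i IHi] im.
  exists void, (fun=> [ffun j => 0]); split; [by rewrite card_void|by case|].
  move=> G pG G0 y; have [_ [[x Fx] _] _] := FZ 0%N im.
  by rewrite -[RHS](G0 x Fx); congr G; apply/ffunP => -[].
have [J [f [cJ pf indep]]] := IHi (ltnW im).
have [clY irrY _] := FZ i (ltnW im); have [clZ irrZ _] := FZ i.+1 im.
have [YZ nZY] := Flt i im.
have [z Zz nYz] : exists2 z, F i.+1 z & ~ F i z.
  by move/existsNP: nZY => [z /not_implyP[]]; exists z.
have [h [ph h0 hz]] := zariski_closed_separate clY nYz.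
exists (option J), (fun x => optcons (h x) (f x)); split.
- by rewrite card_option cJ.
- by case=> [j|]; rewrite /optcons; under eq_fun do rewrite ffunE.
- by apply: (poly_independent_optcons _ YZ) => //; exists z.
Qed.

(** A polynomial that vanishes on the range of phi vanishes on its closure, so independent functions
    on the top of the chain stay independent after pullback to affine space. *)
Lemma chain_length_le I J (phi : affine K I -> affine K J)
    (Z : set (affine K J)) m :
  polymap phi -> Z `<=` zariski_closure (range phi) ->
  irreducible_chain Z m -> (m <= #|I|)%N.
Proof.
move=> pphi Zphi [F [FZ Flt]].
have [J' [f [cJ pf indep]]] := chain_independent FZ Flt (leqnn m).
rewrite -cJ.
have pfphi : polymap (fun t => f (phi t)).
  by move=> j; apply: (pfun_comp (pf j)).
apply: (dominant_card pfphi) => G pG G0.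
apply: (indep) => // x Fx; have [_ _ FmZ] := FZ m (leqnn m).
have /zariski_closureP/(_ (fun x => G (f x))) := Zphi x (FmZ x Fx).
apply; first exact: (pfun_comp pG pf).
by move=> _ [t _ <-]; apply: G0.
Qed.

Definition truncate d (i : nat) (t : affine K 'I_d) : affine K 'I_d :=
  [ffun j : 'I_d => if (j < i)%N then t j else 0].

(** The chain consists of the closures of the images of the truncated parametrizations; [f i]
    vanishes on the i-th closure but not on the next, which makes the inclusion strict. *)
Lemma chain_of_param J d (phi : affine K 'I_d -> affine K J)
    (Z : set (affine K J)) (f : 'I_d -> affine K J -> K) :
  polymap phi -> zariski_closed Z -> (forall t, Z (phi t)) ->
  (forall i, pfun (f i)) ->
  (forall i t, f i (phi (truncate i t)) = 0) ->
  (forall i, exists t, f i (phi (truncate i.+1 t)) != 0) ->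
  irreducible_chain Z d.
Proof.
move=> pphi clZ Zphi pf f0 f1.
have ptr i : polymap (fun t => phi (truncate i t)).
  suff ptr : polymap (@truncate d i) by move=> j; apply: (pfun_comp (pphi j)).
  move=> k; rewrite /truncate; under eq_fun do rewrite ffunE.
  by case: (k < i)%N; solve_pfun.
exists (fun i => zariski_closure (range (fun t => phi (truncate i t)))).
split=> i id.
  split; first exact: zariski_closure_closed.
    exact: closure_range_irreducible.
  by apply: zariski_closure_sub => // _ [t _ <-].
split.
  apply: zariski_closure_sub; first exact: zariski_closure_closed.
  move=> _ [t _ <-]; apply: subset_zariski_closure; exists (truncate i t) => //.
  congr phi; apply/ffunP => j; rewrite !ffunE ltnS.
  by case: (ltnP j i) => [/ltnW ->//|_]; rewrite if_same.
move=> sub; have [t /eqP ft] := f1 (Ordinal id); apply: ft.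
have : zariski_closure (range (fun t => phi (truncate i t)))
    (phi (truncate i.+1 t)).
  by apply: sub; apply: subset_zariski_closure; exists t.
move=> /zariski_closureP; apply; first exact: pf.
by move=> _ [u _ <-]; apply: (f0 (Ordinal id)).
Qed.

End Dimension.

(** * Structure constants and base change *)

Section BaseChange.
Variables (K : numFieldType) (n : nat).
Implicit Types (mu nu : algebra_structure K n) (x y z : 'cV[K]_n) (g h : 'M[K]_n).

Lemma amulDl mu x y z : amul mu (x + y) z = amul mu x z + amul mu y z.
Proof.
apply/colP => k; rewrite !mxE -big_split; apply: eq_bigr => i _.
by rewrite -big_split; apply: eq_bigr => j _; rewrite /= !mxE; ring.
Qed.

Lemma amulDr mu x y z : amul mu x (y + z) = amul mu x y + amul mu x z.
Proof.
apply/colP => k; rewrite !mxE -big_split; apply: eq_bigr => i _.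
by rewrite -big_split; apply: eq_bigr => j _; rewrite /= !mxE; ring.
Qed.

Lemma amulZl mu a x y : amul mu (a *: x) y = a *: amul mu x y.
Proof.
apply/colP => k; rewrite !mxE mulr_sumr; apply: eq_bigr => i _.
by rewrite mulr_sumr; apply: eq_bigr => j _; rewrite /= !mxE; ring.
Qed.

Lemma amulZr mu a x y : amul mu x (a *: y) = a *: amul mu x y.
Proof.
apply/colP => k; rewrite !mxE mulr_sumr; apply: eq_bigr => i _.
by rewrite mulr_sumr; apply: eq_bigr => j _; rewrite /= !mxE; ring.
Qed.

Lemma amul0l mu x : amul mu 0 x = 0.
Proof. by rewrite -(scale0r 0) amulZl !scale0r. Qed.

Lemma amul0r mu x : amul mu x 0 = 0.
Proof. by rewrite -(scale0r 0) amulZr !scale0r. Qed.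

Lemma amul_suml mu x I (r : seq I) (P : pred I) (F : I -> 'cV[K]_n) :
  amul mu (\sum_(i <- r | P i) F i) x = \sum_(i <- r | P i) amul mu (F i) x.
Proof.
by apply: (big_morph (amul mu ^~ x)) => [y z|]; rewrite ?amulDl ?amul0l.
Qed.

Lemma amul_sumr mu x I (r : seq I) (P : pred I) (F : I -> 'cV[K]_n) :
  amul mu x (\sum_(i <- r | P i) F i) = \sum_(i <- r | P i) amul mu x (F i).
Proof.
by apply: (big_morph (amul mu x)) => [y z|]; rewrite ?amulDr ?amul0r.
Qed.

Lemma cV_sum_delta x : x = \sum_i x i 0 *: delta_mx i 0.
Proof.
apply/colP => k; rewrite summxE (bigD1 k) //= !mxE !eqxx mulr1 big1 ?addr0 //.
by move=> i ik; rewrite !mxE eq_sym (negbTE ik) mulr0.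
Qed.

Lemma amul_delta mu i j k :
  amul mu (delta_mx i 0) (delta_mx j 0) k 0 = mu (i, j, k).
Proof.
rewrite mxE (bigD1 i) //= [X in _ + X]big1 ?addr0 => [|i' ii'].
  rewrite (bigD1 j) //= [X in _ + X]big1 ?addr0 => [|j' jj'].
    by rewrite !mxE !eqxx !mulr1.
  by rewrite !mxE (negbTE jj') mulr0.
by rewrite big1 // => j' _; rewrite !mxE (negbTE ii') mulr0 mul0r.
Qed.

Lemma amul_expand mu x y :
  amul mu x y = \sum_i \sum_j (x i 0 * y j 0) *: amul mu (delta_mx i 0) (delta_mx j 0).
Proof.
rewrite {1}(cV_sum_delta x) amul_suml; apply: eq_bigr => i _.
rewrite {1}(cV_sum_delta y) amul_sumr; apply: eq_bigr => j _.
by rewrite amulZl amulZr scalerA.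
Qed.

Lemma amul_inj mu nu :
  (forall i j, amul mu (delta_mx i 0) (delta_mx j 0)
             = amul nu (delta_mx i 0) (delta_mx j 0)) -> mu = nu.
Proof.
by move=> E; apply/ffunP => -[[i j] k]; rewrite -!amul_delta E.
Qed.

Lemma structure_ofE (m : 'I_n -> 'I_n -> 'cV[K]_n) x y :
  amul (structure_of m) x y = \sum_i \sum_j (x i 0 * y j 0) *: m i j.
Proof.
rewrite amul_expand; apply: eq_bigr => i _; apply: eq_bigr => j _.
by congr (_ *: _); apply/colP => k; rewrite amul_delta ffunE.
Qed.

(* [gl_act] with an independent matrix in place of the inverse, so as to be
   polynomial in the matrices. *)
Definition mx_act g h mu : algebra_structure K n :=
  structure_of (fun i j => g *m amul mu (h *m delta_mx i 0) (h *m delta_mx j 0)).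

Lemma amul_mx_act g h mu x y :
  amul (mx_act g h mu) x y = g *m amul mu (h *m x) (h *m y).
Proof.
rewrite structure_ofE.
rewrite {2}(cV_sum_delta x) {2}(cV_sum_delta y) !mulmx_sumr.
rewrite amul_suml mulmx_sumr; apply: eq_bigr => i _.
rewrite amul_sumr mulmx_sumr; apply: eq_bigr => j _.
by rewrite -!scalemxAr amulZl amulZr scalerA -scalemxAr.
Qed.

Lemma amul_gl_act g mu x y :
  amul (gl_act g mu) x y = g *m amul mu (invmx g *m x) (invmx g *m y).
Proof. exact: amul_mx_act. Qed.

Lemma amul_gl_actM g mu x y : g \in unitmx ->
  amul (gl_act g mu) (g *m x) (g *m y) = g *m amul mu x y.
Proof. by move=> gu; rewrite amul_gl_act !mulKmx. Qed.

Lemma gl_actP g mu nu : g \in unitmx ->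
  (forall x y, amul nu (g *m x) (g *m y) = g *m amul mu x y) ->
  nu = gl_act g mu.
Proof.
move=> gu E; apply: amul_inj => i j.
by rewrite amul_gl_act -E !mulKVmx.
Qed.

Lemma gl_act1 mu : gl_act 1%:M mu = mu.
Proof.
by apply/esym/gl_actP => [|x y]; rewrite ?unitmx1 ?mul1mx.
Qed.

Lemma gl_actM g h mu : g \in unitmx -> h \in unitmx ->
  gl_act g (gl_act h mu) = gl_act (g *m h) mu.
Proof.
move=> gu hu; apply: gl_actP => [|x y]; first by rewrite unitmx_mul gu.
by rewrite -!mulmxA !amul_gl_actM.
Qed.

Lemma gl_actK g mu : g \in unitmx -> gl_act (invmx g) (gl_act g mu) = mu.
Proof. by move=> gu; rewrite gl_actM ?unitmx_inv // mulVmx // gl_act1. Qed.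

Lemma gl_act_mx_act g h mu : g *m h = 1%:M -> gl_act g mu = mx_act g h mu.
Proof.
move=> gh; have [gu _] := mulmx1_unit gh.
suff -> : h = invmx g by [].
by rewrite -[LHS](mulKmx gu) gh mulmx1.
Qed.

(** [\adj g] is [\det g] times the inverse and occurs in both arguments, a factor [(\det g) ^+ 2];
    scaling g by k multiplies the structure by the inverse of k, whence the exponent. *)
Lemma gl_act_adj g mu : g \in unitmx ->
  mx_act g (\adj g) mu = gl_act ((\det g) ^- 2 *: g) mu.
Proof.
move=> gu; have d0 : \det g != 0 by rewrite -unitfE -unitmxE.
apply: gl_actP => [|x y]; first by rewrite unitmxZ // unitfE invr_eq0 expf_neq0.
rewrite amul_mx_act -!scalemxAl -!scalemxAr amulZl amulZr -!scalemxAr.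
rewrite !mulmxA mul_adj_mx !mul_scalar_mx amulZl amulZr -!scalemxAr !scalerA.
by congr (_ *: _); field.
Qed.

End BaseChange.

(** * Invariance of terminality, and nilpotency through one-sided products *)

Section Invariants.
Variables (K : numFieldType) (n : nat).
Implicit Types (mu nu : algebra_structure K n) (x y z : 'cV[K]_n) (g h : 'M[K]_n).

Lemma terminal_gl_act g mu :
  g \in unitmx -> terminal_algebra mu -> terminal_algebra (gl_act g mu).
Proof.
move=> gu tmu a x y z.
rewrite -(mulKVmx gu a) -(mulKVmx gu x) -(mulKVmx gu y) -(mulKVmx gu z).
move: (invmx g *m a) (invmx g *m x) (invmx g *m y) (invmx g *m z) => {}a {}x {}y {}z.
have := congr1 (mulmx g) (tmu a x y z); rewrite mulmx0 => <-.
by rewrite /terminal_defect !(amul_gl_actM, mulmxDr, mulmxN) //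
  -!(mulmxBr, mulmxDr) !(amul_gl_actM, mulmxDr, mulmxN).
Qed.

Fixpoint mul_word nu (s : seq (bool * 'cV[K]_n)) x :=
  if s is (b, y) :: s' then
    let z := mul_word nu s' x in if b then amul nu y z else amul nu z y
  else x.

Lemma mul_word_gl_act g mu s x : g \in unitmx ->
  mul_word (gl_act g mu) s x
  = g *m mul_word mu [seq (c.1, invmx g *m c.2) | c <- s] (invmx g *m x).
Proof.
move=> gu; elim: s => [|[b y] s IHs] /=; first by rewrite mulKVmx.
by rewrite IHs; case: b; rewrite -{1}(mulKVmx gu y) amul_gl_actM.
Qed.

(** A binary bracketing tree with more than 2^d leaves has a branch of length at least d + 1; the
    subtrees hanging off that branch are the letters of the word. *)
Lemma product_of_word nu d k x : product_of nu k x -> (2 ^ d < k)%N ->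
  exists s y, size s = d.+1 /\ x = mul_word nu s y.
Proof.
move=> pkx; elim: pkx d => {k x} [x|k l x y px IHx py IHy] d.
  by rewrite ltnNge expn_gt0.
have gt0 m z : product_of nu m z -> (0 < m)%N.
  by elim=> // m1 m2 *; rewrite addn_gt0; apply/orP; left.
case: d => [|d] kl; first by exists [:: (true, x)], y.
have [kd|kd] := ltnP (2 ^ d) k.
  have [s [z [sd ->]]] := IHx d kd.
  by exists ((false, y) :: s), z; rewrite /= sd.
have ld : (2 ^ d < l)%N by move: kl kd; rewrite expnS; lia.
have [s [z [sd ->]]] := IHy d ld.
by exists ((true, x) :: s), z; rewrite /= sd.
Qed.

(** For fixed d the hypothesis is a system of polynomial equations in the structure constants,
    unlike nilpotency with its unknown exponent. *)
Lemma word_nilpotent nu d :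
  (forall s x, size s = d.+1 -> mul_word nu s x = 0) -> nilpotent_algebra nu.
Proof.
move=> w0; exists (2 ^ d).+1 => // x /product_of_word/(_ (ltnSn _)).
by move=> [s [y [sd ->]]]; apply: w0.
Qed.

(* A product of maximal length outside W. *)
Lemma nilpotent_annihilator nu (W : set 'cV[K]_n) :
  nilpotent_algebra nu -> W 0 -> (exists x, ~ W x) ->
  exists x, [/\ ~ W x, forall y, W (amul nu x y) & forall y, W (amul nu y x)].
Proof.
move=> [k k0 nil] W0 [x0 Wx0].
have [N WN] : exists N, forall x, product_of nu N.+1 x -> W x.
  by exists k.-1 => x; rewrite prednK // => /nil ->.
elim: N WN => [|N IHN] WN; first by case: Wx0; apply/WN/product_one.
have [//|/existsNP[x /not_implyP[px Wx]]] :=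
  pselect (forall x, product_of nu N.+1 x -> W x).
exists x; split=> // y; apply: WN.
  by rewrite -addn1; apply: product_mul => //; apply: product_one.
by rewrite -add1n; apply: product_mul => //; apply: product_one.
Qed.

End Invariants.

(** * Closures of families of orbits *)

Section FamilyClosure.
Variables (K : numFieldType) (n : nat).
Implicit Types (mu nu : algebra_structure K n) (g h : 'M[K]_n).

Definition pmx (I : finType) m p (A : affine K I -> 'M[K]_(m, p)) :=
  forall i j, pfun (fun t => A t i j).

Lemma pmx_const (I : finType) m p (A : 'M[K]_(m, p)) :
  pmx (fun _ : affine K I => A).
Proof. by move=> i j; apply: pfun_const. Qed.

Lemma pmx_add (I : finType) m p (A B : affine K I -> 'M[K]_(m, p)) :
  pmx A -> pmx B -> pmx (fun t => A t + B t).
Proof.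
by move=> pA pB i j; under eq_fun do rewrite mxE; apply: pfun_add.
Qed.

Lemma pmx_opp (I : finType) m p (A : affine K I -> 'M[K]_(m, p)) :
  pmx A -> pmx (fun t => - A t).
Proof. by move=> pA i j; under eq_fun do rewrite mxE; apply: pfun_opp. Qed.

Lemma pmx_mulmx (I : finType) m p q (A : affine K I -> 'M[K]_(m, p))
  (B : affine K I -> 'M[K]_(p, q)) : pmx A -> pmx B -> pmx (fun t => A t *m B t).
Proof.
move=> pA pB i j; under eq_fun do rewrite mxE.
by apply: pfun_sum => k; apply: pfun_mul.
Qed.

Lemma pfun_det (I : finType) m (A : affine K I -> 'M[K]_m) :
  pmx A -> pfun (fun t => \det (A t)).
Proof.
move=> pA; apply: pfun_sum => s; apply: pfun_mul; first exact: pfun_const.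
exact: pfun_prod.
Qed.

Lemma pmx_adj (I : finType) m (A : affine K I -> 'M[K]_m) :
  pmx A -> pmx (fun t => \adj (A t)).
Proof.
move=> pA i j; under eq_fun do rewrite mxE /cofactor.
apply: pfun_mul; first exact: pfun_const.
by apply: pfun_det => k l; under eq_fun do rewrite !mxE.
Qed.

Lemma pmx_amul (I : finType) (nu : affine K I -> algebra_structure K n) x y :
  polymap nu -> pmx x -> pmx y -> pmx (fun t => amul (nu t) (x t) (y t)).
Proof.
move=> pnu px py k l; under eq_fun do rewrite mxE.
by do 2![apply: pfun_sum => ?]; do ?apply: pfun_mul.
Qed.

Lemma polymap_mx_act (I : finType) (nu : affine K I -> algebra_structure K n)
    (A B : affine K I -> 'M[K]_n) :
  polymap nu -> pmx A -> pmx B -> polymap (fun t => mx_act (A t) (B t) (nu t)).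
Proof.
move=> pnu pA pB -[[i j] k]; under eq_fun do rewrite ffunE.
apply: pmx_mulmx => //.
by apply: pmx_amul => //; apply: pmx_mulmx => //; apply: pmx_const.
Qed.

Lemma polymap_id (I : finType) : polymap (fun t : affine K I => t).
Proof. by move=> i; apply: pfun_coord. Qed.

Lemma polymap_gl_act g : polymap (@gl_act K n g).
Proof.
apply: (@polymap_mx_act _ id (fun=> g) (fun=> invmx g)).
- exact: polymap_id.
- exact: pmx_const.
- exact: pmx_const.
Qed.

Variable F : set (algebra_structure K n).

Lemma family_closure_closed : zariski_closed (family_closure F).
Proof. exact: zariski_closure_closed. Qed.

Lemma family_closure_orbit g mu :
  g \in unitmx -> F mu -> family_closure F (gl_act g mu).
Proof.
by move=> gu Fmu; apply: subset_zariski_closure; exists mu => //; exists g.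
Qed.

Lemma family_closure_sub (Z : set (algebra_structure K n)) :
  zariski_closed Z -> (forall g mu, g \in unitmx -> F mu -> Z (gl_act g mu)) ->
  family_closure F `<=` Z.
Proof.
move=> clZ FZ; apply: zariski_closure_sub => // _ [mu Fmu [g gu ->]].
exact: FZ.
Qed.

Lemma family_closure_gl g mu :
  g \in unitmx -> family_closure F mu -> family_closure F (gl_act g mu).
Proof.
move=> gu; apply: (family_closure_sub
  (Z := [set mu | family_closure F (gl_act g mu)])).
  apply: zariski_closed_preimage; last exact: family_closure_closed.
  exact: polymap_gl_act.
move=> h nu hu Fnu /=; rewrite gl_actM //.
by apply: family_closure_orbit => //; rewrite unitmx_mul gu.
Qed.

End FamilyClosure.

(** * Strictly triangular algebras of dimension four *)

Section Dimension4.
Variable K : numFieldType.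
Implicit Types (mu nu : algebra_structure K 4).

(** Explicit coordinates turn an identity between structures into four scalar identities, within
    reach of [ring] and [field]. *)
Definition vec4 (a b c d : K) : 'cV[K]_4 := \col_i [:: a; b; c; d]`_i.

Definition mx4 (a11 a12 a13 a14 a21 a22 a23 a24
                a31 a32 a33 a34 a41 a42 a43 a44 : K) : 'M[K]_4 :=
  \matrix_(i, j) (nth [::] [:: [:: a11; a12; a13; a14]; [:: a21; a22; a23; a24];
                     [:: a31; a32; a33; a34]; [:: a41; a42; a43; a44]] i)`_j.

Lemma ord4_ind (P : 'I_4 -> Prop) :
  P (inord 0) -> P (inord 1) -> P (inord 2) -> P (inord 3) -> forall i, P i.
Proof.
move=> P0 P1 P2 P3 i.
have -> : i = inord i by rewrite inord_val.
by case: i => -[|[|[|[|//]]]].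
Qed.

Lemma vec4E a b c d : (vec4 a b c d (inord 0) 0 = a)
  * (vec4 a b c d (inord 1) 0 = b) * (vec4 a b c d (inord 2) 0 = c)
  * (vec4 a b c d (inord 3) 0 = d).
Proof. by rewrite !mxE !inordK. Qed.

Lemma vec4_inj a b c d a' b' c' d' : vec4 a b c d = vec4 a' b' c' d' ->
  [/\ a = a', b = b', c = c' & d = d'].
Proof.
move/colP=> E.
by split; [have := E (inord 0)|have := E (inord 1)|have := E (inord 2)
  |have := E (inord 3)]; rewrite !vec4E.
Qed.

Lemma vec4_eta (x : 'cV[K]_4) :
  x = vec4 (x (inord 0) 0) (x (inord 1) 0) (x (inord 2) 0) (x (inord 3) 0).
Proof. by apply/colP; apply: ord4_ind; rewrite vec4E. Qed.

Lemma vec4P (x : 'cV[K]_4) : exists a b c d, x = vec4 a b c d.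
Proof. by do 4!eexists; apply: vec4_eta. Qed.

Lemma vec4D a b c d a' b' c' d' : vec4 a b c d + vec4 a' b' c' d'
  = vec4 (a + a') (b + b') (c + c') (d + d').
Proof. by apply/colP; apply: ord4_ind; rewrite mxE !vec4E. Qed.

Lemma vec4N a b c d : - vec4 a b c d = vec4 (- a) (- b) (- c) (- d).
Proof. by apply/colP; apply: ord4_ind; rewrite mxE !vec4E. Qed.

Lemma vec4Z k a b c d :
  k *: vec4 a b c d = vec4 (k * a) (k * b) (k * c) (k * d).
Proof. by apply/colP; apply: ord4_ind; rewrite mxE !vec4E. Qed.

Lemma vec4_0 : 0 = vec4 0 0 0 0.
Proof. by apply/colP; apply: ord4_ind; rewrite mxE !vec4E. Qed.

Definition vec4lin := (vec4D, vec4N, vec4Z, vec4_0).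

Lemma sum4 (V : nmodType) (F : 'I_4 -> V) :
  \sum_i F i = F (inord 0) + F (inord 1) + F (inord 2) + F (inord 3).
Proof.
rewrite 4!big_ord_recl big_ord0 addr0 !addrA.
by congr (_ + _ + _ + _); congr F; apply: val_inj; rewrite /= inordK.
Qed.

Lemma mul_mx4_vec4 a11 a12 a13 a14 a21 a22 a23 a24
    a31 a32 a33 a34 a41 a42 a43 a44 x y z t :
  mx4 a11 a12 a13 a14 a21 a22 a23 a24 a31 a32 a33 a34 a41 a42 a43 a44
    *m vec4 x y z t
  = vec4 (a11 * x + a12 * y + a13 * z + a14 * t)
         (a21 * x + a22 * y + a23 * z + a24 * t)
         (a31 * x + a32 * y + a33 * z + a34 * t)
         (a41 * x + a42 * y + a43 * z + a44 * t).
Proof.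
by apply/colP; apply: ord4_ind; rewrite mxE sum4 !vec4E !mxE !inordK.
Qed.

Lemma delta4 (i : 'I_4) : delta_mx i 0
  = vec4 (i == 0%N :> nat)%:R (i == 1%N :> nat)%:R (i == 2 :> nat)%:R
         (i == 3 :> nat)%:R :> 'cV[K]_4.
Proof.
apply/colP; apply: ord4_ind; rewrite vec4E mxE andbT; congr (_%:R);
  by rewrite -val_eqE /= inordK // eq_sym.
Qed.

Lemma mx4_eq (A B : 'M[K]_4) : (forall x : 'cV_4, A *m x = B *m x) -> A = B.
Proof.
move=> E; apply/matrixP => i j.
by have /colP/(_ i) := E (delta_mx j 0); rewrite -!colE !mxE.
Qed.

Lemma unitmx4P (A : 'M[K]_4) :
  (forall x : 'cV_4, A *m x = 0 -> x = 0) -> A \in unitmx.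
Proof.
move=> A0; rewrite -unitmx_tr -row_free_unit -kermx_eq0.
apply/eqP/row_matrixP => i; rewrite row0.
have /sub_kermxP : (row i (kermx A^T) <= kermx A^T)%MS by apply: row_sub.
move/(congr1 trmx); rewrite trmx_mul trmxK trmx0 => /A0/(congr1 trmx).
by rewrite trmxK trmx0.
Qed.

(** Lower triangular, with the entries listed by columns: each column is the image of a basis
    vector. *)
Definition lt4 a11 a21 a31 a41 a22 a32 a42 a33 a43 a44 :=
  mx4 a11 0 0 0 a21 a22 0 0 a31 a32 a33 0 a41 a42 a43 a44.

Lemma lt4_unit a11 a21 a31 a41 a22 a32 a42 a33 a43 a44 :
  a11 != 0 -> a22 != 0 -> a33 != 0 -> a44 != 0 ->
  lt4 a11 a21 a31 a41 a22 a32 a42 a33 a43 a44 \in unitmx.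
Proof.
move=> n1 n2 n3 n4; apply: unitmx4P => x.
have [a [b [c [d ->]]]] := vec4P x; rewrite mul_mx4_vec4 vec4_0.
have cancel (u v' : K) : u != 0 -> u * v' = 0 -> v' = 0.
  by move=> /negPf u0 /eqP; rewrite mulf_eq0 u0 => /eqP.
case/vec4_inj; rewrite !mul0r !addr0 => /(cancel _ _ n1)->.
rewrite mulr0 add0r => /(cancel _ _ n2)->.
rewrite !mulr0 !add0r => /(cancel _ _ n3)->.
by rewrite !mulr0 !add0r => /(cancel _ _ n4)->.
Qed.

(* Parameters: e1e1 = c2 e2 + c3 e3 + c4 e4, e1e2 = p e3 + p' e4,
   e2e1 = q e3 + q' e4, e2e2 = r e3 + r' e4, and then the coefficients at e4
   of e1e3, e3e1, e2e3, e3e2, e3e3. *)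
Definition tri c2 c3 c4 p p' q q' r r' u v w m s : algebra_structure K 4 :=
  structure_of (fun i j : 'I_4 =>
    match nat_of_ord i, nat_of_ord j with
    | 0%N, 0%N => vec4 0 c2 c3 c4
    | 0%N, 1%N => vec4 0 0 p p'
    | 1%N, 0%N => vec4 0 0 q q'
    | 1%N, 1%N => vec4 0 0 r r'
    | 0%N, 2%N => vec4 0 0 0 u
    | 2%N, 0%N => vec4 0 0 0 v
    | 1%N, 2%N => vec4 0 0 0 w
    | 2%N, 1%N => vec4 0 0 0 m
    | 2%N, 2%N => vec4 0 0 0 s
    | _, _ => 0
    end).

Lemma amul_tri c2 c3 c4 p p' q q' r r' u v w m s x0 x1 x2 x3 y0 y1 y2 y3 :
  amul (tri c2 c3 c4 p p' q q' r r' u v w m s) (vec4 x0 x1 x2 x3)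
    (vec4 y0 y1 y2 y3)
  = vec4 0 (c2 * (x0 * y0))
      (c3 * (x0 * y0) + p * (x0 * y1) + q * (x1 * y0) + r * (x1 * y1))
      (c4 * (x0 * y0) + p' * (x0 * y1) + q' * (x1 * y0) + r' * (x1 * y1)
       + u * (x0 * y2) + v * (x2 * y0) + w * (x1 * y2) + m * (x2 * y1)
       + s * (x2 * y2)).
Proof.
rewrite structure_ofE !sum4 !inordK // !vec4E !vec4lin.
by congr vec4; ring.
Qed.

Lemma structure4_eq mu nu :
  (forall x0 x1 x2 x3 y0 y1 y2 y3,
    amul mu (vec4 x0 x1 x2 x3) (vec4 y0 y1 y2 y3)
    = amul nu (vec4 x0 x1 x2 x3) (vec4 y0 y1 y2 y3)) -> mu = nu.
Proof.
by move=> E; apply: amul_inj => i j; rewrite !delta4.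
Qed.

Lemma gl_act4P g mu nu : g \in unitmx ->
  (forall x0 x1 x2 x3 y0 y1 y2 y3,
    amul nu (g *m vec4 x0 x1 x2 x3) (g *m vec4 y0 y1 y2 y3)
    = g *m amul mu (vec4 x0 x1 x2 x3) (vec4 y0 y1 y2 y3)) ->
  nu = gl_act g mu.
Proof.
move=> gu E; apply: gl_actP => // x y.
by have [? [? [? [? ->]]]] := vec4P x; have [? [? [? [? ->]]]] := vec4P y.
Qed.

Lemma table4E (m : nat -> nat -> 'cV[K]_4) x0 x1 x2 x3 y0 y1 y2 y3 :
  amul (table4 m) (vec4 x0 x1 x2 x3) (vec4 y0 y1 y2 y3) =
  (x0 * y0) *: m 1%N 1%N + (x0 * y1) *: m 1%N 2
     + (x0 * y2) *: m 1%N 3 + (x0 * y3) *: m 1%N 4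
  + ((x1 * y0) *: m 2 1%N + (x1 * y1) *: m 2 2
     + (x1 * y2) *: m 2 3 + (x1 * y3) *: m 2 4)
  + ((x2 * y0) *: m 3 1%N + (x2 * y1) *: m 3 2
     + (x2 * y2) *: m 3 3 + (x2 * y3) *: m 3 4)
  + ((x3 * y0) *: m 4 1%N + (x3 * y1) *: m 4 2
     + (x3 * y2) *: m 4 3 + (x3 * y3) *: m 4 4).
Proof. by rewrite structure_ofE !sum4 !inordK // !vec4E. Qed.

Lemma eE : (e K 2 = vec4 0 1 0 0) * (e K 3 = vec4 0 0 1 0)
  * (e K 4 = vec4 0 0 0 1).
Proof. by rewrite /e !delta4 !inordK. Qed.

Lemma D01E lambda alpha beta :
  D01 lambda alpha beta = tri 0 lambda 1 0 0 1 0 1 0 alpha 1 beta 0 0.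
Proof.
apply: structure4_eq => *; rewrite amul_tri table4E !eE !vec4lin.
by congr vec4; ring.
Qed.

Lemma T41E alpha : T41 alpha = tri 1 0 0 0 alpha 1 0 0 0 (-1) 3 1 0 0.
Proof.
apply: structure4_eq => *; rewrite amul_tri table4E !eE !vec4lin.
by congr vec4; ring.
Qed.

Lemma T43E lambda alpha : T43 lambda alpha
  = tri 1 0 0 lambda 0 1 0 0 1 (alpha * (lambda - 1) + 1) (3 * alpha) 0 0 0.
Proof.
apply: structure4_eq => *; rewrite amul_tri table4E !eE !vec4lin.
by congr vec4; ring.
Qed.

End Dimension4.

(** * Normal forms of generic triangular algebras *)

Section NormalForms.
Variable K : numFieldType.
Implicit Types (mu nu : algebra_structure K 4).

Definition vals n (s : seq K) : affine K 'I_n := [ffun i : 'I_n => s`_i].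

Lemma polymap_tri (I : finType)
    (c2 c3 c4 p p' q q' r r' u v w m s : affine K I -> K) :
  pfun c2 -> pfun c3 -> pfun c4 -> pfun p -> pfun p' -> pfun q -> pfun q' ->
  pfun r -> pfun r' -> pfun u -> pfun v -> pfun w -> pfun m -> pfun s ->
  polymap (fun t => tri (c2 t) (c3 t) (c4 t) (p t) (p' t) (q t) (q' t) (r t)
    (r' t) (u t) (v t) (w t) (m t) (s t)).
Proof.
move=> ? ? ? ? ? ? ? ? ? ? ? ? ? ? -[[i j] k].
under eq_fun do rewrite ffunE /=.
case: i j k => -[|[|[|[|//]]]] ? -[[|[|[|[|//]]]] ?] -[[|[|[|[|//]]]] ?] /=;
  by under eq_fun do rewrite !mxE /=; solve_pfun.
Qed.

(** The matrix is forced by its first column z(e1 + c x e2): the others are what e1e1 = e2, e2e1 =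
    e3 and e2e3 = e4 make of it. The values of e2e2, e1e3 and e3e1 on the left express e2e2 = 0,
    e1e3 = -e4 and e3e1 = 3e4, and alpha is read off e1e2. *)
Lemma T41_normal_form (c a b p' q q' x z w : K) : c != 0 -> q != 0 -> z != 0 ->
  w != 0 -> exists alpha g, g \in unitmx /\
  tri c (c * a) (c * b) 0 p' q q' 0 (- w * (q * x + a)) (- (c * w * (z + x)))
    (3 * c * w * z) w 0 0 = gl_act g (T41 alpha).
Proof.
move=> c0 q0 z0 w0; pose r' := - w * (q * x + a).
pose u := - (c * w * (z + x)); pose v := 3 * c * w * z.
pose d := z ^+ 5 * q * c ^+ 2 * w.
exists (z ^+ 3 * (p' * c + u * (c * a + c * x * q)
  + c * x * (r' * c + w * (c * a + c * x * q))) / d).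
exists (lt4 z (z * (c * x)) 0 0
  (z ^+ 2 * c) (z ^+ 2 * (c * a + c * x * q))
    (z ^+ 2 * (c * b + c * x * (p' + q') + (c * x) ^+ 2 * r'))
  (z ^+ 3 * q * c)
    (z ^+ 3 * (q' * c + c * x * c * r' + v * (c * a + c * x * q))) d).
split.
  by apply: lt4_unit; rewrite /d ?mulf_neq0 ?expf_neq0.
rewrite T41E; apply: gl_act4P => [|x0 x1 x2 x3 y0 y1 y2 y3].
  by apply: lt4_unit; rewrite /d ?mulf_neq0 ?expf_neq0.
rewrite amul_tri /lt4 !mul_mx4_vec4 amul_tri /d /u /v /r'.
by congr vec4; field; rewrite ?c0 ?q0 ?z0 ?w0.
Qed.

(** Again the first column e1 + x e2 determines the others, through e1e1 = e2, e2e1 = e3 and e2e2 =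
    e4. The formula for r' is the relation for e1e3; p' is the e4-coordinate of e1e2 = lambda e3,
    where E collects the terms in x. *)
Lemma T43_normal_form (c a b p q q' u v x : K) :
  let r' := q * u + (q - p) * v / 3 in
  let E := (q - p) * r' + (p + q) * (q * u - p * v) in
  let p' := (p * q' + c * a * (p * v - q * u) - x * E) / q in
  c != 0 -> q != 0 -> r' != 0 -> exists lambda alpha g, g \in unitmx /\
  tri c (c * a) (c * b) p p' q q' 0 r' (c * u) (c * v) 0 0 0
    = gl_act g (T43 lambda alpha).
Proof.
move=> r' E p' c0 q0 r0; exists (p / q), (v * q / (3 * r')).
exists (lt4 1 x 0 0
  c (c * a + x * (p + q)) (c * b + x * (p' + q') + x ^+ 2 * r')
  (q * c) (q' * c + x * c * r' + c * v * (c * a + x * (p + q)))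
  (c ^+ 2 * r')).
have gu : lt4 1 x 0 0
  c (c * a + x * (p + q)) (c * b + x * (p' + q') + x ^+ 2 * r')
  (q * c) (q' * c + x * c * r' + c * v * (c * a + x * (p + q)))
  (c ^+ 2 * r') \in unitmx.
  by apply: lt4_unit; rewrite ?oner_eq0 ?mulf_neq0 ?expf_neq0.
have r0' : q * u * 3 + (q - p) * v != 0.
  have -> : q * u * 3 + (q - p) * v = 3 * r' by rewrite /r'; field.
  by rewrite mulf_neq0 ?pnatr_eq0.
split=> //; rewrite T43E; apply: gl_act4P => // x0 x1 x2 x3 y0 y1 y2 y3.
rewrite amul_tri /lt4 !mul_mx4_vec4 amul_tri /p' /E /r'.
by congr vec4; field; rewrite q0 r0'.
Qed.

(* The parameters u and v are e1e3 and e3e1 divided by c, which makes the value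
   of e2e2 imposed by terminality polynomial. *)
Definition alg41 c q p' q' u v w a b : algebra_structure K 4 :=
  tri c (c * a) (c * b) 0 p' q q' 0 (q * (u + v / 3) - a * w) (c * u) (c * v)
    w 0 0.

Definition alg43 c q p' q' u v p a b : algebra_structure K 4 :=
  tri c (c * a) (c * b) p p' q q' 0 (q * u + (q - p) * v / 3) (c * u) (c * v)
    0 0 0.

Definition algD c3 c4 p p' q q' r r' u v w m : algebra_structure K 4 :=
  tri 0 c3 c4 p p' q q' r r' u v w m 0.

Lemma alg41_closure c q p' q' u v w a b :
  family_closure (T41_family K) (alg41 c q p' q' u v w a b).
Proof.
have generic : forall c q p' q' u v w a b, c != 0 -> q != 0 ->
    v != 0 -> w != 0 ->
    family_closure (T41_family K) (alg41 c q p' q' u v w a b).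
  move=> {}c {}q {}p' {}q' {}u {}v {}w {}a {}b c0 q0 v0 w0.
  (* z and x solve cv = 3cwz and cu = -cw(z + x); the value of e2e2 then agrees. *)
  have z0 : v / (3 * w) != 0.
    by rewrite mulf_neq0 ?invr_eq0 ?mulf_neq0 ?pnatr_eq0.
  have [al [g [gu E]]] :=
    T41_normal_form a b p' q' (- (u + v / 3) / w) c0 q0 z0 w0.
  have -> : alg41 c q p' q' u v w a b = gl_act g (T41 al).
    by rewrite -E /alg41; congr tri; field.
  by apply: family_closure_orbit => //; exists al.
pose phi (t : affine K 'I_9) := alg41 (t (inord 0)) (t (inord 1)) (t (inord 2))
  (t (inord 3)) (t (inord 4)) (t (inord 5)) (t (inord 6)) (t (inord 7))
  (t (inord 8)).
suff H : forall t, family_closure (T41_family K) (phi t).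
  by have := H (vals 9 [:: c; q; p'; q'; u; v; w; a; b]);
    rewrite /phi !ffunE !inordK.
apply: (@closed_of_generic _ _ _ phi (fun t => t (inord 0) * t (inord 1)
  * t (inord 5) * t (inord 6)) [ffun=> 1]).
- by apply: polymap_tri; solve_pfun.
- by solve_pfun.
- by rewrite !ffunE !mul1r oner_eq0.
- exact: family_closure_closed.
move=> t; rewrite !mulf_eq0 !negb_or => /andP[/andP[/andP[c0 q0] v0] w0].
exact: generic.
Qed.

Lemma alg43_closure c q p' q' u v p a b :
  family_closure (T43_family K) (alg43 c q p' q' u v p a b).
Proof.
pose r' q u v p : K := q * u + (q - p) * v / 3.
pose E q u v p : K := (q - p) * r' q u v p + (p + q) * (q * u - p * v).
have generic : forall c q p' q' u v p a b, c != 0 -> q != 0 ->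
    r' q u v p != 0 -> E q u v p != 0 ->
    family_closure (T43_family K) (alg43 c q p' q' u v p a b).
  move=> {}c {}q {}p' {}q' {}u {}v {}p {}a {}b c0 q0 r0 E0.
  (* The formula for p' in the normal form is affine in x with slope -E / q, and is solved for x. *)
  pose x := (p * q' + c * a * (p * v - q * u) - q * p') / E q u v p.
  have [la [al [g [gu EQ]]]] := T43_normal_form a b q' x c0 q0 r0.
  have -> : alg43 c q p' q' u v p a b = gl_act g (T43 la al).
    rewrite -EQ /alg43; congr tri; rewrite -/(r' q u v p) -/(E q u v p) /x.
    by field; rewrite q0 E0.
  by apply: family_closure_orbit => //; exists la, al.
pose phi (t : affine K 'I_9) := alg43 (t (inord 0)) (t (inord 1)) (t (inord 2))
  (t (inord 3)) (t (inord 4)) (t (inord 5)) (t (inord 6)) (t (inord 7))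
  (t (inord 8)).
suff H : forall t, family_closure (T43_family K) (phi t).
  by have := H (vals 9 [:: c; q; p'; q'; u; v; p; a; b]);
    rewrite /phi !ffunE !inordK.
(* At the point c = q = u = 1, all else 0 (also past the end of the list), r' is 1 and E is 2. *)
apply: (@closed_of_generic _ _ _ phi (fun t => t (inord 0) * t (inord 1)
  * r' (t (inord 1)) (t (inord 4)) (t (inord 5)) (t (inord 6))
  * E (t (inord 1)) (t (inord 4)) (t (inord 5)) (t (inord 6)))
  (vals 9 [:: 1; 1; 0; 0; 1; 0; 0])).
- by apply: polymap_tri; solve_pfun.
- by rewrite /E /r'; solve_pfun.
- rewrite !ffunE !inordK //= /E /r'.
  rewrite (_ : _ * _ = 2) ?pnatr_eq0 //; ring.
- exact: family_closure_closed.
move=> t; rewrite !mulf_eq0 !negb_or => /andP[/andP[/andP[c0 q0] r0] E0].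
exact: generic.
Qed.

(** * From the family D01 to all of [algD], one basis change at a time *)

Section ClosureD.
Local Notation ZD := (family_closure (D01_family K)).

(** The diagonal matrix is determined by normalising to 1 the products e2e2, e2e1, e3e1 and the
    e4-coordinate of e1e1; the three remaining constants become lambda, alpha and beta. *)
Lemma D01_scaling (c3 c4 q r u v w : K) : c4 != 0 -> q != 0 -> r != 0 -> v != 0 ->
  ZD (algD c3 c4 0 0 q 0 r 0 u v w 0).
Proof.
move=> c0 q0 r0 v0; pose b := c4 / (v * q); pose a := r * b / q.
pose c := r * b ^+ 2; pose d := v * a * c.
have a0 : a != 0 by rewrite !mulf_neq0 ?invr_eq0 ?mulf_neq0.
have b0 : b != 0 by rewrite !mulf_neq0 ?invr_eq0 ?mulf_neq0.
have gu : lt4 a 0 0 0 b 0 0 c 0 d \in unitmx.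
  have nc : c != 0 by rewrite mulf_neq0 ?expf_neq0.
  by apply: lt4_unit => //; apply: mulf_neq0 (mulf_neq0 v0 a0) nc.
suff -> : algD c3 c4 0 0 q 0 r 0 u v w 0 = gl_act (lt4 a 0 0 0 b 0 0 c 0 d)
    (D01 (c3 * r / q ^+ 2) (u / v) (w * q / (v * r))).
  by apply: family_closure_orbit => //; do 3!eexists.
rewrite D01E; apply: gl_act4P => // x0 x1 x2 x3 y0 y1 y2 y3.
rewrite amul_tri !mul_mx4_vec4 amul_tri /d /c /a /b.
by congr vec4; field; rewrite ?c0 ?q0 ?r0 ?v0.
Qed.

Lemma algD_closure_scaling c3 c4 q r u v w :
  ZD (algD c3 c4 0 0 q 0 r 0 u v w 0).
Proof.
pose phi (t : affine K 'I_7) := algD (t (inord 0)) (t (inord 1)) 0 0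
  (t (inord 2)) 0 (t (inord 3)) 0 (t (inord 4)) (t (inord 5)) (t (inord 6)) 0.
suff H : forall t, ZD (phi t).
  by have := H (vals 7 [:: c3; c4; q; r; u; v; w]); rewrite /phi !ffunE !inordK.
apply: (@closed_of_generic _ _ _ phi (fun t => t (inord 1) * t (inord 2)
  * t (inord 3) * t (inord 5)) [ffun=> 1]).
- by apply: polymap_tri; solve_pfun.
- by solve_pfun.
- by rewrite !ffunE !mul1r oner_eq0.
- exact: family_closure_closed.
move=> t; rewrite !mulf_eq0 !negb_or => /andP[/andP[/andP[c0 q0] r0] v0].
exact: D01_scaling.
Qed.

Lemma algD_closure_shift c3 c4 p' q q' r r' u v w :
  ZD (algD c3 c4 0 p' q q' r r' u v w 0).
Proof.
have generic : forall c3 c4 p' q q' r r' u v w, r != 0 -> u != 0 -> w != 0 ->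
    ZD (algD c3 c4 0 p' q q' r r' u v w 0).
  move=> {}c3 {}c4 {}p' {}q {}q' {}r {}r' {}u {}v {}w r0 u0 w0.
  (* e1, e2, e3 move to e1 + x e3, e2 + y e3, e3 + z e4; y, z and x in turn remove the
     e4-coordinates of e1e2, e2e2 and e2e1. *)
  pose y := - p' / u; pose z := (r' + w * y) / r.
  pose x := (q * z - q' - v * y) / w.
  have gu : lt4 1 0 x 0 1 y 0 1 z 1 \in unitmx.
    by apply: lt4_unit; apply: oner_neq0.
  suff -> : algD c3 c4 0 p' q q' r r' u v w 0 = gl_act (lt4 1 0 x 0 1 y 0 1 z 1)
      (algD c3 (c4 + x * (u + v) - c3 * z) 0 0 q 0 r 0 u v w 0).
    by apply: family_closure_gl => //; apply: algD_closure_scaling.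
  apply: gl_act4P => // x0 x1 x2 x3 y0 y1 y2 y3.
  rewrite amul_tri !mul_mx4_vec4 amul_tri /x /z /y.
  by congr vec4; field; rewrite ?r0 ?u0 ?w0.
pose phi (t : affine K 'I_10) := algD (t (inord 0)) (t (inord 1)) 0
  (t (inord 2)) (t (inord 3)) (t (inord 4)) (t (inord 5)) (t (inord 6))
  (t (inord 7)) (t (inord 8)) (t (inord 9)) 0.
suff H : forall t, ZD (phi t).
  by have := H (vals 10 [:: c3; c4; p'; q; q'; r; r'; u; v; w]);
    rewrite /phi !ffunE !inordK.
apply: (@closed_of_generic _ _ _ phi (fun t => t (inord 5) * t (inord 7)
  * t (inord 9)) [ffun=> 1]).
- by apply: polymap_tri; solve_pfun.
- by solve_pfun.
- by rewrite !ffunE !mul1r oner_eq0.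
- exact: family_closure_closed.
move=> t; rewrite !mulf_eq0 !negb_or => /andP[/andP[r0 u0] w0].
exact: generic.
Qed.

Lemma algD_closure_left c3 c4 p p' q q' r r' u v w :
  ZD (algD c3 c4 p p' q q' r r' u v w 0).
Proof.
have generic : forall c3 c4 p p' q q' r r' u v w, r != 0 ->
    ZD (algD c3 c4 p p' q q' r r' u v w 0).
  move=> {}c3 {}c4 {}p {}p' {}q {}q' {}r {}r' {}u {}v {}w r0.
  (* Replacing e1 by e1 + k e2 removes the e3-coordinate of e1e2. *)
  pose k := - p / r.
  have gu : lt4 1 k 0 0 1 0 0 1 0 1 \in unitmx.
    by apply: lt4_unit; apply: oner_neq0.
  suff -> : algD c3 c4 p p' q q' r r' u v w 0 = gl_act (lt4 1 k 0 0 1 0 0 1 0 1)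
      (algD (c3 + k * (p + q) + k ^+ 2 * r) (c4 + k * (p' + q') + k ^+ 2 * r') 0
        (p' + k * r') (q + k * r) (q' + k * r') r r' (u + k * w) v w 0).
    by apply: family_closure_gl => //; apply: algD_closure_shift.
  apply: gl_act4P => // x0 x1 x2 x3 y0 y1 y2 y3.
  rewrite amul_tri !mul_mx4_vec4 amul_tri /k.
  by congr vec4; field; rewrite ?r0.
pose phi (t : affine K 'I_11) := algD (t (inord 0)) (t (inord 1))
  (t (inord 2)) (t (inord 3)) (t (inord 4)) (t (inord 5)) (t (inord 6))
  (t (inord 7)) (t (inord 8)) (t (inord 9)) (t (inord 10)) 0.
suff H : forall t, ZD (phi t).
  by have := H (vals 11 [:: c3; c4; p; p'; q; q'; r; r'; u; v; w]);
    rewrite /phi !ffunE !inordK.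
apply: (@closed_of_generic _ _ _ phi (fun t => t (inord 6)) [ffun=> 1]).
- by apply: polymap_tri; solve_pfun.
- by solve_pfun.
- by rewrite !ffunE oner_eq0.
- exact: family_closure_closed.
by move=> t r0; apply: generic.
Qed.

Lemma algD_closure c3 c4 p p' q q' r r' u v w m :
  ZD (algD c3 c4 p p' q q' r r' u v w m).
Proof.
have generic : forall c3 c4 p p' q q' r r' u v w m, v != 0 ->
    ZD (algD c3 c4 p p' q q' r r' u v w m).
  move=> {}c3 {}c4 {}p {}p' {}q {}q' {}r {}r' {}u {}v {}w {}m v0.
  (* Replacing e2 by e2 + k e1 removes e3e2. This leaves the triangular group but keeps the plane of
     e3 and e4. *)
  pose k := - m / v; pose g := mx4 1 k 0 0 0 1 0 0 0 0 1 0 0 0 0 1.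
  have gu : g \in unitmx.
    suff /mulmx1_unit[] : g *m mx4 1 (- k) 0 0 0 1 0 0 0 0 1 0 0 0 0 1 = 1%:M by [].
    apply: mx4_eq => x; rewrite -mulmxA mul1mx.
    have [? [? [? [? ->]]]] := vec4P x; rewrite !mul_mx4_vec4.
    by congr vec4; ring.
  suff -> : algD c3 c4 p p' q q' r r' u v w m = gl_act g
      (algD c3 c4 (p + k * c3) (p' + k * c4) (q + k * c3) (q' + k * c4)
        (r + k * (p + q) + k ^+ 2 * c3) (r' + k * (p' + q') + k ^+ 2 * c4)
        u v (w + k * u) 0).
    by apply: family_closure_gl => //; apply: algD_closure_left.
  apply: gl_act4P => // x0 x1 x2 x3 y0 y1 y2 y3.
  rewrite amul_tri !mul_mx4_vec4 amul_tri /k.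
  by congr vec4; field; rewrite ?v0.
pose phi (t : affine K 'I_12) := algD (t (inord 0)) (t (inord 1))
  (t (inord 2)) (t (inord 3)) (t (inord 4)) (t (inord 5)) (t (inord 6))
  (t (inord 7)) (t (inord 8)) (t (inord 9)) (t (inord 10)) (t (inord 11)).
suff H : forall t, ZD (phi t).
  by have := H (vals 12 [:: c3; c4; p; p'; q; q'; r; r'; u; v; w; m]);
    rewrite /phi !ffunE !inordK.
apply: (@closed_of_generic _ _ _ phi (fun t => t (inord 9)) [ffun=> 1]).
- by apply: polymap_tri; solve_pfun.
- by solve_pfun.
- by rewrite !ffunE oner_eq0.
- exact: family_closure_closed.
by move=> t v0; apply: generic.
Qed.

End ClosureD.

End NormalForms.

(** * Every nilpotent terminal algebra lies in one of the three closures *)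

Section Classification.
Variable K : numFieldType.
Implicit Types (mu nu : algebra_structure K 4).

(* The terminal identity at e1 and f = e2 + a e3 + b e4, where e1e1 = c f. *)
Lemma terminal_tri (c a b p p' q q' r r' u v w m s : K) : c != 0 ->
  terminal_algebra (tri c (c * a) (c * b) p p' q q' r r' u v w m s) ->
  [/\ r = 0, 3 * (q * u) + (q - p) * v = 3 * c * (r' + a * (w + m) + a ^+ 2 * s),
      [/\ p * w = 0, p * m = 0 & q * m = 0], s * p = 0 & s * q = 0].
Proof.
move=> c0 T; pose x1 : 'cV[K]_4 := vec4 1 0 0 0; pose x2 := vec4 0 1 a b.
have := T x1 x1 x1 x1.
rewrite /terminal_defect /x1 !(amul_tri, vec4lin) => /vec4_inj[_ _ E3 E4].
have r0 : r = 0.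
  apply/eqP; have /eqP : -3 * c ^+ 2 * r = 0 by rewrite -E3; ring.
  by rewrite !mulf_eq0 (negPf c0) oppr_eq0 pnatr_eq0 /=.
subst r.
have := T x2 x1 x1 x1.
rewrite /terminal_defect /x1 /x2 !(amul_tri, vec4lin) => /vec4_inj[_ _ _ E5].
have := T x1 x1 x2 x1.
rewrite /terminal_defect /x1 /x2 !(amul_tri, vec4lin) => /vec4_inj[_ _ _ E6].
have := T x1 x1 x1 x2.
rewrite /terminal_defect /x1 /x2 !(amul_tri, vec4lin) => /vec4_inj[_ _ _ E7].
have := T x2 x2 x1 x1.
rewrite /terminal_defect /x1 /x2 !(amul_tri, vec4lin) => /vec4_inj[_ _ _ E8].
have := T x1 x1 x2 x2.
rewrite /terminal_defect /x1 /x2 !(amul_tri, vec4lin) => /vec4_inj[_ _ _ E9].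
have sq0 : s * q = 0.
  apply/eqP; have /eqP : s * (q ^+ 2) = 0.
    by apply: (mulfI (_ : -2 != 0)); rewrite ?oppr_eq0 ?pnatr_eq0 // mulr0 -E8; ring.
  by rewrite expr2 mulrA mulf_eq0 => /orP[//|/eqP ->]; rewrite mulr0.
have sp0 : s * p = 0.
  apply/eqP; have /eqP : s * (p ^+ 2) = 0.
    by apply: (mulfI (_ : -2 != 0)); rewrite ?oppr_eq0 ?pnatr_eq0 // mulr0 -E9; ring.
  by rewrite expr2 mulrA mulf_eq0 => /orP[//|/eqP ->]; rewrite mulr0.
have cancel (x : K) : c * x = 0 -> x = 0.
  by move/eqP; rewrite mulf_eq0 (negPf c0) => /eqP.
have {}E5 : 2 * (p * w) - 2 * (q * m) + 2 * a * (s * p) - 2 * a * (s * q) = 0.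
  by apply: cancel; rewrite -[RHS]E5; ring.
have {}E6 : 2 * (p * m) + p * w + 3 * a * (s * p) = 0.
  by apply: cancel; rewrite -oppr0 -[X in - X]E6; ring.
have {}E7 : q * m - p * m - 3 * (p * w) - 4 * a * (s * p) + a * (s * q) = 0.
  by apply: cancel; rewrite -[RHS]E7; ring.
(* Three linear equations in pw, pm and qm remain, with only the zero solution. *)
rewrite sp0 sq0 !mulr0 ?addr0 ?subr0 in E5 E6 E7.
have pw0 : p * w = 0.
  have {}E6 : p * m = - (p * w) / 2 by apply/eqP; rewrite -subr_eq0; apply/eqP;
    rewrite -(mulr0 2^-1) -E6; field.
  have {}E5 : q * m = p * w by apply/eqP; rewrite -subr_eq0; apply/eqP;
    rewrite -(mulr0 (- 2^-1)) -E5; field.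
  by rewrite E6 E5 in E7; rewrite -(mulr0 (- 2 / 3)) -E7; field.
split=> //.
- apply/eqP; rewrite -subr_eq0; apply/eqP; apply: cancel.
  by rewrite -[RHS]E4; ring.
- split=> //.
    by rewrite -(mulr0 2^-1) -E6 pw0; field.
  by rewrite -(mulr0 (- 2^-1)) -E5 pw0; field.
Qed.

(** With the arguments taken among e1 and e2, the e4-coordinate of the identity becomes a nonzero
    integer times s times the square of one e3-coordinate. *)
Lemma terminal_tri0 (c3 c4 p p' q q' r r' u v w m s : K) :
  terminal_algebra (tri 0 c3 c4 p p' q q' r r' u v w m s) -> s != 0 ->
  [/\ c3 = 0, p = 0, q = 0 & r = 0].
Proof.
move=> T s0; pose x1 : 'cV[K]_4 := vec4 1 0 0 0.
pose x2 : 'cV[K]_4 := vec4 0 1 0 0.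
have cancel (k x : K) : k != 0 -> k * s * x ^+ 2 = 0 -> x = 0.
  by move=> k0 /eqP; rewrite !mulf_eq0 (negPf k0) (negPf s0) /= orbb => /eqP.
have n3 : (3 : K) != 0 by rewrite pnatr_eq0.
have n2 : (2 : K) != 0 by rewrite pnatr_eq0.
have := T x1 x1 x1 x1.
rewrite /terminal_defect /x1 !(amul_tri, vec4lin) => /vec4_inj[_ _ _ E].
have c30 : c3 = 0 by apply: (cancel 3) => //; rewrite -oppr0 -[X in - X]E; ring.
subst c3; have {E} := T x2 x2 x2 x2.
rewrite /terminal_defect /x2 !(amul_tri, vec4lin) => /vec4_inj[_ _ _ E].
have r0 : r = 0 by apply: (cancel 3) => //; rewrite -oppr0 -[X in - X]E; ring.
subst r; have {E} := T x1 x1 x2 x2.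
rewrite /terminal_defect /x1 /x2 !(amul_tri, vec4lin) => /vec4_inj[_ _ _ E].
have p0 : p = 0 by apply: (cancel 2) => //; rewrite -oppr0 -[X in - X]E; ring.
subst p; have {E} := T x2 x2 x1 x1.
rewrite /terminal_defect /x1 /x2 !(amul_tri, vec4lin) => /vec4_inj[_ _ _ E].
have q0 : q = 0 by apply: (cancel 2) => //; rewrite -oppr0 -[X in - X]E; ring.
by [].
Qed.

(** Otherwise the coordinates of the basis vectors in terms of x, y, z factor the identity matrix of
    rank 4 through K^3. *)
Lemma exists_notin_span3 (x y z : 'cV[K]_4) :
  exists t, forall a b c, t <> a *: x + b *: y + c *: z.
Proof.
apply: contrapT => H.
have /choice[f Ef] t : exists abc : K * K * K,
    t = abc.1.1 *: x + abc.1.2 *: y + abc.2 *: z.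
  apply: contrapT => Ht; apply: H; exists t => a b c Et.
  by apply: Ht; exists (a, b, c).
pose X : 'M[K]_(4, 3) := \matrix_(i, j) [:: x i 0; y i 0; z i 0]`_j.
pose B : 'M[K]_(3, 4) := \matrix_(i, j)
  let abc := f (delta_mx j 0) in [:: abc.1.1; abc.1.2; abc.2]`_i.
have XB : X *m B = 1%:M.
  apply/matrixP => i j; rewrite !mxE !big_ord_recl big_ord0 !mxE /=.
  have /colP/(_ i) := Ef (delta_mx j 0); rewrite !mxE /= andbT => ->.
  by ring.
have := mxrankM_maxl X B; rewrite XB mxrank1.
by move=> /leq_trans/(_ (rank_leq_col X)).
Qed.

Lemma nilpotent_tri nu : nilpotent_algebra nu ->
  exists g c2 c3 c4 p p' q q' r r' u v w m s,
    g \in unitmx /\ nu = gl_act g (tri c2 c3 c4 p p' q q' r r' u v w m s).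
Proof.
move=> nil.
(* Modulo the span of x, y, z there is an annihilating vector outside it. From the zero span this
   yields e4, e3, e2 and e1, in this order. *)
have step (x y z : 'cV[K]_4) : exists t,
   [/\ forall a b c, t <> a *: x + b *: y + c *: z,
       forall s, exists a b c, amul nu t s = a *: x + b *: y + c *: z
     & forall s, exists a b c, amul nu s t = a *: x + b *: y + c *: z].
  pose W := [set t | exists a b c, t = a *: x + b *: y + c *: z].
  have [||t [Wt Wl Wr]] := nilpotent_annihilator (W := W) nil.
  - by exists 0, 0, 0; rewrite !scale0r !addr0.
  - have [t Ht] := exists_notin_span3 x y z.
    by exists t => -[a [b [c]]]; apply: Ht.
  by exists t; split=> // a b c Et; apply: Wt; exists a, b, c.
have [x4 [n4 l4 r4]] := step 0 0 0.
have [x3 [n3 l3 r3]] := step 0 0 x4.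
have [x2 [n2 l2 r2]] := step 0 x3 x4.
have [x1 [n1 l1 r1]] := step x2 x3 x4.
have {}l4 s : amul nu x4 s = 0.
  by have [a [b [c ->]]] := l4 s; rewrite !scaler0 !addr0.
have {}r4 s : amul nu s x4 = 0.
  by have [a [b [c ->]]] := r4 s; rewrite !scaler0 !addr0.
have {}l3 s : exists c, amul nu x3 s = c *: x4.
  by have [a [b [c ->]]] := l3 s; exists c; rewrite !scaler0 !add0r.
have {}r3 s : exists c, amul nu s x3 = c *: x4.
  by have [a [b [c ->]]] := r3 s; exists c; rewrite !scaler0 !add0r.
have {}l2 s : exists b c, amul nu x2 s = b *: x3 + c *: x4.
  by have [a [b [c ->]]] := l2 s; exists b, c; rewrite !scaler0 !add0r.
have {}r2 s : exists b c, amul nu s x2 = b *: x3 + c *: x4.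
  by have [a [b [c ->]]] := r2 s; exists b, c; rewrite !scaler0 !add0r.
pose g : 'M[K]_4 := \matrix_(i, j) [:: x1 i 0; x2 i 0; x3 i 0; x4 i 0]`_j.
have gE a b c d : g *m vec4 a b c d = a *: x1 + b *: x2 + c *: x3 + d *: x4.
  apply/colP => i; rewrite mxE sum4 !vec4E !mxE !inordK //=; ring.
have gu : g \in unitmx.
  apply: unitmx4P => x; have [a [b [c [d ->]]]] := vec4P x.
  rewrite gE => /eqP; have [->|a0] := eqVneq a 0; last first.
    rewrite -!addrA addr_eq0 => /eqP/(congr1 ( *:%R a^-1)).
    rewrite scalerA mulVf // scale1r => Ex.
    case: (n1 (- (a^-1 * b)) (- (a^-1 * c)) (- (a^-1 * d))).
    by rewrite Ex !scalerN !scaleNr -!opprD !scalerDr !scalerA !addrA.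
  rewrite scale0r add0r; have [->|b0] := eqVneq b 0; last first.
    rewrite -!addrA addr_eq0 => /eqP/(congr1 ( *:%R b^-1)).
    rewrite scalerA mulVf // scale1r => Ex.
    case: (n2 0 (- (b^-1 * c)) (- (b^-1 * d))).
    by rewrite Ex scale0r add0r !scalerN !scaleNr -!opprD !scalerDr !scalerA.
  rewrite scale0r add0r; have [->|c0] := eqVneq c 0; last first.
    rewrite addr_eq0 => /eqP/(congr1 ( *:%R c^-1)).
    rewrite scalerA mulVf // scale1r => Ex.
    case: (n3 0 0 (- (c^-1 * d))).
    by rewrite Ex !scale0r !add0r !scalerN !scaleNr scalerA.
  rewrite scale0r add0r scaler_eq0 => /orP[/eqP->|/eqP x40].
    by rewrite -vec4_0.
  by case: (n4 0 0 0); rewrite !scale0r !addr0.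
have [c2 [c3 [c4 E11]]] := l1 x1; have [p [p' E12]] := r2 x1.
have [q [q' E21]] := l2 x1; have [r [r' E22]] := l2 x2.
have [u E13] := r3 x1; have [v E31] := l3 x1.
have [w E23] := r3 x2; have [m E32] := l3 x2; have [s E33] := l3 x3.
exists g, c2, c3, c4, p, p', q, q', r, r', u, v, w, m, s; split=> //.
apply: gl_act4P => // a0 a1 a2 a3 b0 b1 b2 b3.
rewrite amul_tri !gE !(amulDl, amulDr, amulZl, amulZr) !l4 !r4.
rewrite E11 E12 E13 E21 E22 E23 E31 E32 E33.
by apply/colP => i; rewrite !mxE; ring.
Qed.

Lemma tri_alg41 (c a b p' q q' r' u v w : K) : c != 0 ->
  3 * (q * u) + q * v = 3 * c * (r' + a * w) ->
  tri c (c * a) (c * b) 0 p' q q' 0 r' u v w 0 0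
    = alg41 c q p' q' (u / c) (v / c) w a b.
Proof.
move=> c0 E; have -> : r' = (3 * (q * u) + q * v) / (3 * c) - a * w.
  by rewrite E; field.
by congr tri; field.
Qed.

Lemma tri_alg43 (c a b p p' q q' r' u v : K) : c != 0 ->
  3 * (q * u) + (q - p) * v = 3 * c * r' ->
  tri c (c * a) (c * b) p p' q q' 0 r' u v 0 0 0
    = alg43 c q p' q' (u / c) (v / c) p a b.
Proof.
move=> c0 E; have -> : r' = (3 * (q * u) + (q - p) * v) / (3 * c).
  by rewrite E; field.
by congr tri; field.
Qed.

End Classification.

(** * The case distinction over an algebraically closed field *)

Section Cover.
Variable K : numClosedFieldType.
Implicit Types (mu nu : algebra_structure K 4).

Lemma quadratic_root (a b c : K) : a != 0 -> exists z, c + b * z + a * z ^+ 2 = 0.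
Proof.
move=> a0; exists ((sqrtC (b ^+ 2 - 4 * a * c) - b) / (2 * a)).
set d := sqrtC _; have Ed : d ^+ 2 = b ^+ 2 - 4 * a * c by rewrite sqrtCK.
have -> : c = (b ^+ 2 - d ^+ 2) / (4 * a) by rewrite Ed; field.
by field.
Qed.

(** All products lie on the line of e4, so the algebra is a bilinear form. [algD] requires e3e3 = 0;
    for s <> 0 an isotropic vector e1 + z e3 takes the place of e3. *)
Lemma tri_algD c4 p' q' r' u v w m s :
  exists g c3 c4' p q p1 q1 r r1 u' v' w' m', g \in unitmx /\
  tri 0 0 c4 0 p' 0 q' 0 r' u v w m s
    = gl_act g (algD c3 c4' p p1 q q1 r r1 u' v' w' m') :> algebra_structure K 4.
Proof.
have [->|s0] := eqVneq s 0.
  exists 1%:M; do 12!eexists; split; first exact: unitmx1.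
  by rewrite gl_act1; reflexivity.
have [z Ez] := quadratic_root (u + v) c4 s0.
pose g : 'M[K]_4 := mx4 0 0 1 0 0 1 0 0 1 0 z 0 0 0 0 1.
exists g, 0, s, 0, 0, m, w, 0, r', (v + z * s), (u + z * s), (q' + z * w), (p' + z * m).
have gu : g \in unitmx.
  suff /mulmx1_unit[] : g *m mx4 (- z) 0 1 0 0 1 0 0 1 0 0 0 0 0 0 1 = 1%:M by [].
  apply: mx4_eq => x; rewrite -mulmxA mul1mx.
  have [? [? [? [? ->]]]] := vec4P x; rewrite !mul_mx4_vec4.
  by congr vec4; ring.
split=> //; apply: gl_act4P => // x0 x1 x2 x3 y0 y1 y2 y3.
have -> : c4 = - ((u + v) * z + s * z ^+ 2).
  by apply/eqP; rewrite -addr_eq0 addrA Ez.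
by rewrite amul_tri !mul_mx4_vec4 amul_tri; congr vec4; ring.
Qed.

(** Apart from e1e1 = c f with f = e2 + a e3 + b e4, all products of basis vectors lie on the line
    of e4. So f can take the place of e3, and e3 that of e2; the hypothesis says ff = 0. *)
Lemma tri_swap_algD c a b p' q' r' u v w m s : r' + a * (w + m) + a ^+ 2 * s = 0 ->
  exists2 g, g \in unitmx & tri c (c * a) (c * b) 0 p' 0 q' 0 r' u v w m s
    = gl_act g (algD c 0 0 u 0 v 0 s (p' + a * u) (q' + a * v) (m + a * s)
        (w + a * s)) :> algebra_structure K 4.
Proof.
move=> Er; pose g : 'M[K]_4 := mx4 1 0 0 0 0 0 1 0 0 1 a 0 0 0 b 1.
have gu : g \in unitmx.
  suff /mulmx1_unit[] : g *m mx4 1 0 0 0 0 (- a) 1 0 0 1 0 0 0 (- b) 0 1 = 1%:M by [].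
  apply: mx4_eq => x; rewrite -mulmxA mul1mx.
  have [? [? [? [? ->]]]] := vec4P x; rewrite !mul_mx4_vec4.
  by congr vec4; ring.
exists g => //; apply: gl_act4P => // x0 x1 x2 x3 y0 y1 y2 y3.
have -> : r' = - (a * (w + m) + a ^+ 2 * s).
  by apply/eqP; rewrite -addr_eq0 addrA Er.
by rewrite amul_tri !mul_mx4_vec4 amul_tri; congr vec4; ring.
Qed.

Lemma nilpotent_terminal_cover nu : nilpotent_terminal K 4 nu ->
  [\/ family_closure (D01_family K) nu, family_closure (T41_family K) nu
    | family_closure (T43_family K) nu].
Proof.
move=> [/nilpotent_tri]
  [g [c2 [c3 [c4 [p [p' [q [q' [r [r' [u [v [w [m [s [gu ->]]]]]]]]]]]]]]]].
move=> T; have {T} : terminal_algebra (tri c2 c3 c4 p p' q q' r r' u v w m s).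
  by rewrite -(gl_actK (tri _ _ _ _ _ _ _ _ _ _ _ _ _ _) gu);
    apply: terminal_gl_act; rewrite // unitmx_inv.
have [->|c0] := eqVneq c2 0.
  move=> T; constructor 1; apply: family_closure_gl => //.
  have [->|s0] := eqVneq s 0; first exact: algD_closure.
  have [-> -> -> ->] := terminal_tri0 T s0.
  have [h [? [? [? [? [? [? [? [? [? [? [? [? [hu ->]]]]]]]]]]]]]] :=
    tri_algD c4 p' q' r' u v w m s.
  by apply: family_closure_gl => //; apply: algD_closure.
rewrite -(mulfVK c0 c3) -(mulfVK c0 c4) !(mulrC _ c2).
move: (c3 / c2) (c4 / c2) => a b T.
have [-> Er [pw0 pm0 qm0] sp0 sq0] := terminal_tri c0 T.
have n3 : (3 : K) != 0 by rewrite pnatr_eq0.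
(* p <> 0 forces w = m = s = 0 and leads to [alg43]; p = 0 <> q forces m = s = 0 and leads to
   [alg41]; p = q = 0 makes the square of f vanish and leads back to [algD]. *)
have [p0|p0] := eqVneq p 0; last first.
  have w0 : w = 0 by apply: (mulfI p0); rewrite mulr0.
  have m0 : m = 0 by apply: (mulfI p0); rewrite mulr0.
  have s0 : s = 0 by apply: (mulIf p0); rewrite mul0r.
  constructor 3; apply: family_closure_gl => //.
  rewrite w0 m0 s0 tri_alg43 //; first exact: alg43_closure.
  by rewrite Er w0 m0 s0; ring.
have [q0|q0] := eqVneq q 0; last first.
  have m0 : m = 0 by apply: (mulfI q0); rewrite mulr0.
  have s0 : s = 0 by apply: (mulIf q0); rewrite mul0r.
  constructor 2; apply: family_closure_gl => //.
  rewrite p0 m0 s0 tri_alg41 //; first exact: alg41_closure.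
  by move: Er; rewrite p0 m0 s0 subr0 => ->; ring.
constructor 1; apply: family_closure_gl => //; rewrite p0 q0.
have [|h hu ->] := @tri_swap_algD c2 a b p' q' r' u v w m s.
  apply: (mulfI (mulf_neq0 n3 c0)); rewrite -Er p0 q0; ring.
by apply: family_closure_gl => //; apply: algD_closure.
Qed.

End Cover.

(** * Flags and triangular structures *)

Section Flags.
Variable K : numFieldType.
Implicit Types (mu nu : algebra_structure K 4) (b g : 'M[K]_4).

(** Indices start at 0: [flag 0] is the whole space, [flag 2] the plane of e3 and e4, [flag 3] the
    line of e4, [flag 4] zero. *)
Definition flag k (v : 'cV[K]_4) := forall i : 'I_4, (i < k)%N -> v i 0 = 0.

Definition flag_stable k b := forall v, flag k v -> flag k (b *m v).

Lemma flagP k v :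
  flag k v <-> (v^T <= \matrix_(i, j) ((i == j) && (k <= j)%N)%:R)%MS.
Proof.
set D := (X in (_ <= X)%MS).
have ED (w : 'rV[K]_4) j : (w *m D) 0 j = w 0 j *+ (k <= j)%N.
  rewrite mxE (bigD1 j) //= big1 ?addr0 => [|i ij]; rewrite !mxE.
    by rewrite eqxx mulr_natr.
  by rewrite (negbTE ij) mulr0.
split=> [Fv|/submxP[w Ew] i ik].
  apply/submxP; exists v^T; apply/rowP => j; rewrite ED mxE.
  by case: leqP => [//|/Fv ->]; rewrite mul0rn.
by have /rowP/(_ i) := Ew; rewrite ED mxE leqNgt ik mulr0n.
Qed.

(** An injective linear map of a finite-dimensional space into itself is onto; here this is a
    comparison of ranks of row spaces. *)
Lemma flag_stable_inv k b :
  b \in unitmx -> flag_stable k b -> flag_stable k (invmx b).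
Proof.
move=> bu bk v /flagP vk; apply/flagP; move: vk.
set D := (X in (_ <= X)%MS) => vD.
have Db : (D *m b^T <= D)%MS.
  apply/row_subP => i; rewrite row_mul -[row i D]trmxK -trmx_mul.
  by apply/flagP/bk/flagP; rewrite trmxK row_sub.
have btu : row_free b^T by rewrite row_free_unit unitmx_tr.
have DDb : (D <= D *m b^T)%MS.
  have := mxrank_leqif_eq Db; rewrite mxrankMfree // => -[_].
  by rewrite eqxx => /esym/andP[].
rewrite trmx_mul; apply: submx_trans (submxMr _ vD) _.
apply: submx_trans (submxMr _ DDb) _.
by rewrite -mulmxA -trmx_mul mulVmx // trmx1 mulmx1.
Qed.

Lemma flag_mulV k b v : b \in unitmx -> flag_stable k b ->
  flag k (b *m v) -> flag k v.
Proof. by move=> bu bk /(flag_stable_inv bu bk); rewrite mulKmx. Qed.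

Definition flag_alg nu := forall k x y, flag k x ->
  flag k.+1 (amul nu x y) /\ flag k.+1 (amul nu y x).

Lemma flag_alg_gl b mu : b \in unitmx -> (forall k, flag_stable k b) ->
  flag_alg mu -> flag_alg (gl_act b mu).
Proof.
move=> bu bs fmu k x y xk.
have x'k : flag k (invmx b *m x) by apply: flag_stable_inv.
have [xy yx] := fmu k (invmx b *m x) (invmx b *m y) x'k.
by rewrite !amul_gl_act; split; apply: bs.
Qed.

Lemma flag_delta (i : 'I_4) : flag i (delta_mx i 0).
Proof.
by move=> j ji; rewrite mxE andbT; case: eqP ji => // ->; rewrite ltnn.
Qed.

Lemma flag_alg_tri nu : flag_alg nu ->
  exists c2 c3 c4 p p' q q' r r' u v w m s,
    nu = tri c2 c3 c4 p p' q q' r r' u v w m s.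
Proof.
move=> fnu; pose c i j k := nu (inord i, inord j, inord k).
have zero (i j k : 'I_4) : (k <= i)%N || (k <= j)%N -> nu (i, j, k) = 0.
  have [+ _] := fnu i _ (delta_mx j 0) (@flag_delta i).
  have [_ +] := fnu j _ (delta_mx i 0) (@flag_delta j).
  move=> /(_ k); rewrite ltnS amul_delta => H1 /(_ k); rewrite ltnS amul_delta.
  by move=> H2 /orP[/H2|/H1].
exists (c 0 0 1), (c 0 0 2), (c 0 0 3), (c 0 1 2), (c 0 1 3), (c 1 0 2),
  (c 1 0 3), (c 1 1 2), (c 1 1 3), (c 0 2 3), (c 2 0 3), (c 1 2 3), (c 2 1 3),
  (c 2 2 3).
apply/ffunP => -[[i j] k]; move: i j k.
apply: ord4_ind; apply: ord4_ind; apply: ord4_ind; rewrite ffunE /= !inordK //;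
  rewrite ?vec4E ?mxE //; by apply: zero; rewrite !inordK.
Qed.

Lemma flag_tri c2 c3 c4 p p' q q' r r' u v w m s :
  flag_alg (tri c2 c3 c4 p p' q q' r r' u v w m s).
Proof.
move=> k x y; have [x0 [x1 [x2 [x3 ->]]]] := vec4P x.
have [y0 [y1 [y2 [y3 ->]]]] := vec4P y => fx; rewrite !amul_tri.
have E (i : nat) : (i < 4)%N -> (i < k)%N -> [:: x0; x1; x2; x3]`_i = 0.
  move=> i4 ik; rewrite -[RHS](fx (inord i)) ?inordK //.
  by rewrite mxE inordK.
have E1 : (0 < k)%N -> x0 = 0 by exact: (E 0%N).
have E2 : (1 < k)%N -> x0 = 0 /\ x1 = 0.
  by move=> k1; split; [apply: E1; apply: ltnW|apply: (E 1%N)].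
have E3 : (2 < k)%N -> [/\ x0 = 0, x1 = 0 & x2 = 0].
  by move=> k2; have [-> ->] := E2 (ltnW k2); split=> //; apply: (E 2).
split; apply: ord4_ind; rewrite vec4E inordK // ltnS.
- by move/E1->; ring.
- by move/E2=> [-> ->]; ring.
- by move/E3=> [-> -> ->]; ring.
- by move/E1->; ring.
- by move/E2=> [-> ->]; ring.
- by move/E3=> [-> -> ->]; ring.
Qed.

Lemma flag0 k x0 x1 x2 x3 : (k <= 4)%N ->
  flag k (vec4 x0 x1 x2 x3) <-> forall i, (i < k)%N -> [:: x0; x1; x2; x3]`_i = 0.
Proof.
move=> k4; split=> [fx i ik|fx i ik]; last by rewrite mxE fx.
by rewrite -[RHS](fx (inord i)) ?mxE inordK // (leq_trans ik).
Qed.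

Lemma flag3P v : flag 3 v <-> exists t, v = vec4 0 0 0 t.
Proof.
split=> [fv|[t ->]]; last by apply/flag0 => // -[|[|[|]]].
by exists (v (inord 3) 0); rewrite [LHS]vec4_eta (fv (inord 0)) ?inordK //
    (fv (inord 1)) ?inordK //
    (fv (inord 2)) ?inordK //.
Qed.

Lemma flag2P v : flag 2 v <-> exists z t, v = vec4 0 0 z t.
Proof.
split=> [fv|[z [t ->]]]; last by apply/flag0 => // -[|[|[|]]].
by exists (v (inord 2) 0), (v (inord 3) 0);
  rewrite [LHS]vec4_eta (fv (inord 0)) ?inordK //
    (fv (inord 1)) ?inordK //.
Qed.

Lemma flag1P v : flag 1 v <-> exists y z t, v = vec4 0 y z t.
Proof.
split=> [fv|[y [z [t ->]]]]; last by apply/flag0 => // -[|[|[|]]].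
exists (v (inord 1) 0), (v (inord 2) 0), (v (inord 3) 0).
by rewrite [LHS]vec4_eta (fv (inord 0)) ?inordK //.
Qed.

Lemma flag_stable_lt4 a11 a21 a31 a41 a22 a32 a42 a33 a43 a44 k :
  flag_stable k (lt4 a11 a21 a31 a41 a22 a32 a42 a33 a43 a44).
Proof.
move=> v fv i ik; rewrite mxE big1 // => j _.
have [ij|ji] := leqP j i; first by rewrite fv ?mulr0 // (leq_ltn_trans ij).
suff -> : lt4 a11 a21 a31 a41 a22 a32 a42 a33 a43 a44 i j = 0 by rewrite mul0r.
by move: i j {ik} ji; do 2!apply: ord4_ind; rewrite !mxE !inordK.
Qed.

(** Diagonal blocks of sizes 2, 1, 1: the invertible ones form the stabilizer of the plane [flag 2]
    and the line [flag 3]. *)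
Lemma flag_stable_block a11 a12 a21 a22 a31 a32 a33 a41 a42 a43 a44 k :
  (1 < k)%N -> flag_stable k
    (mx4 a11 a12 0 0 a21 a22 0 0 a31 a32 a33 0 a41 a42 a43 a44).
Proof.
move=> k1 v fv i ik; rewrite mxE big1 // => j _.
have [ij|ji] := leqP j i; first by rewrite fv ?mulr0 // (leq_ltn_trans ij).
have [j1|j1] := leqP j 1; first by rewrite fv ?mulr0 // (leq_ltn_trans j1).
set b := mx4 _ _ _ _ _ _ _ _ _ _ _ _ _ _ _ _.
suff -> : b i j = 0 by rewrite mul0r.
by rewrite /b; move: i j {ik} ji j1; do 2!apply: ord4_ind; rewrite !mxE !inordK.
Qed.

(* A coordinate-free description of [algD], relative to the flag. *)
Definition plane_alg nu :=
  [/\ forall x y, flag 2 (amul nu x y),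
      forall x y, flag 2 x -> flag 3 (amul nu x y) /\ flag 3 (amul nu y x),
      forall x y, flag 2 x -> flag 2 y -> amul nu x y = 0
    & forall x y, flag 3 x -> amul nu x y = 0 /\ amul nu y x = 0].

Lemma plane_alg_gl b mu : b \in unitmx -> flag_stable 2 b -> flag_stable 3 b ->
  plane_alg mu -> plane_alg (gl_act b mu).
Proof.
move=> bu b2 b3 [H1 H2 H3 H4].
have i2 := flag_stable_inv bu b2; have i3 := flag_stable_inv bu b3.
split=> x y; rewrite !amul_gl_act.
- exact/b2/H1.
- move=> /i2 x2; have [xy yx] := H2 _ (invmx b *m y) x2.
  by split; apply: b3.
- by move=> /i2 x2 /i2 y2; rewrite H3 // mulmx0.
- move=> /i3 x3; have [-> ->] := H4 _ (invmx b *m y) x3.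
  by rewrite mulmx0.
Qed.

Lemma plane_alg_algD c3 c4 p p' q q' r r' u v w m :
  plane_alg (algD c3 c4 p p' q q' r r' u v w m).
Proof.
split=> x y; have [x0 [x1 [x2 [x3 ->]]]] := vec4P x;
  have [y0 [y1 [y2 [y3 ->]]]] := vec4P y; rewrite !amul_tri.
- by apply/flag2P; do 2!eexists; congr vec4; ring.
- move=> /flag2P[z [t /vec4_inj[-> -> _ _]]].
  by split; apply/flag3P; eexists; congr vec4; ring.
- move=> /flag2P[z [t /vec4_inj[-> -> _ _]]].
  move=> /flag2P[z' [t' /vec4_inj[-> -> _ _]]].
  by rewrite [RHS]vec4_0; congr vec4; ring.
- move=> /flag3P[t /vec4_inj[-> -> -> _]].
  by split; rewrite [RHS]vec4_0; congr vec4; ring.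
Qed.

Lemma plane_algP nu : plane_alg nu -> exists c3 c4 p p' q q' r r' u v w m,
  nu = algD c3 c4 p p' q q' r r' u v w m.
Proof.
move=> [H1 H2 H3 H4].
have mono j k x : (k <= j)%N -> flag j x -> flag k x.
  by move=> kj fx i ik; apply: fx; apply: leq_trans kj.
have flag4 x k : x = 0 -> flag k x by move=> -> i _; rewrite mxE.
have fnu : flag_alg nu.
  case=> [|[|[|k]]] x y fx; split.
  - exact: mono (H1 _ _).
  - exact: mono (H1 _ _).
  - exact: (H1 _ _).
  - exact: (H1 _ _).
  - by have [] := H2 x y fx.
  - by have [] := H2 x y fx.
  - by apply: flag4; have [] := H4 x y (mono k.+3 3 x isT fx).
  - by apply: flag4; have [] := H4 x y (mono k.+3 3 x isT fx).
have [c2 [c3 [c4 [p [p' [q [q' [r [r' [u [v [w [m [s E]]]]]]]]]]]]]] :=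
  flag_alg_tri fnu.
subst nu.
have := H1 (vec4 1 0 0 0) (vec4 1 0 0 0); rewrite amul_tri => /flag2P.
move=> [z [t /vec4_inj[_ c20 _ _]]].
have := H3 (vec4 0 0 1 0) (vec4 0 0 1 0); rewrite amul_tri [0 in RHS]vec4_0.
have f2 : flag 2 (vec4 0 0 1 0) by apply/flag2P; exists 1, 0.
move=> /(_ f2 f2)/vec4_inj[_ _ _ s0].
exists c3, c4, p, p', q, q', r, r', u, v, w, m; rewrite /algD; congr tri.
  by rewrite -[RHS]c20; ring.
by rewrite -[RHS]s0; ring.
Qed.

(** For a terminal [tri] with c2 <> 0, that is with [square_plane] violated, [left_inner_line]
    amounts to p = 0, [flags_annihilate 2 1] to m = s = 0 and [flags_annihilate 1 2] to w = s =
    0. *)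
Definition left_inner_line nu := forall x y z, flag 3 (amul nu x (amul nu y z)).

Definition flags_annihilate k l nu :=
  forall x y, flag k x -> flag l y -> amul nu x y = 0.

Definition square_plane nu := forall x y, flag 2 (amul nu x y).

Lemma left_inner_line_gl b mu : b \in unitmx -> flag_stable 3 b ->
  left_inner_line mu -> left_inner_line (gl_act b mu).
Proof.
by move=> bu b3 H x y z; rewrite !amul_gl_act mulKmx //; apply/b3/H.
Qed.

Lemma flags_annihilate_gl k l b mu : b \in unitmx -> flag_stable k b ->
  flag_stable l b -> flags_annihilate k l mu -> flags_annihilate k l (gl_act b mu).
Proof.
move=> bu bk bl H x y xk yl; rewrite amul_gl_act H ?mulmx0 //.
  exact: (flag_stable_inv bu bk).
exact: (flag_stable_inv bu bl).
Qed.

Lemma square_plane_gl b mu : b \in unitmx -> flag_stable 2 b ->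
  square_plane (gl_act b mu) -> square_plane mu.
Proof.
move=> bu b2 H x y; apply: (flag_mulV bu b2).
by rewrite -amul_gl_actM.
Qed.

Lemma flag_alg_normal nu : flag_alg nu -> terminal_algebra nu ->
  ~ square_plane nu -> exists c a (b : K) p p' q q' r' u v w m s,
  [/\ c != 0, nu = tri c (c * a) (c * b) p p' q q' 0 r' u v w m s
    & 3 * (q * u) + (q - p) * v = 3 * c * (r' + a * (w + m) + a ^+ 2 * s)].
Proof.
move=> /flag_alg_tri
  [c2 [c3 [c4 [p [p' [q [q' [r [r' [u [v [w [m [s ->]]]]]]]]]]]]]] T nsq.
have c0 : c2 != 0.
  apply/eqP=> c0; apply: nsq => x y; have [? [? [? [? ->]]]] := vec4P x.
  have [? [? [? [? ->]]]] := vec4P y; rewrite amul_tri c0 mul0r.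
  by apply/flag2P; do 2!eexists.
have [E3 E4] : c3 = c2 * (c3 / c2) /\ c4 = c2 * (c4 / c2) by split; field.
rewrite E3 E4 in T *; have [r0 E _ _ _] := terminal_tri c0 T.
by do 13!eexists; split; [exact: c0|rewrite r0; reflexivity|exact: E].
Qed.

Lemma alg41P nu : flag_alg nu -> terminal_algebra nu -> ~ square_plane nu ->
  left_inner_line nu -> flags_annihilate 2 1 nu ->
  exists c q p' q' u v w a (b : K), nu = alg41 c q p' q' u v w a b.
Proof.
move=> fnu T nsq L N.
have [c [a [b [p [p' [q [q' [r' [u [v [w [m [s [c0 E E']]]]]]]]]]]]]] :=
  flag_alg_normal fnu T nsq.
subst nu; have := L (vec4 1 0 0 0) (vec4 1 0 0 0) (vec4 1 0 0 0).
rewrite !amul_tri => /flag3P[t /vec4_inj[_ _ p0 _]].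
have {}p0 : p = 0 by apply: (mulfI c0); rewrite mulr0 -[RHS]p0; ring.
have f2 : flag 2 (vec4 0 0 1 0) by apply/flag2P; do 2!eexists.
have := N (vec4 0 0 1 0) (vec4 0 0 1 0) f2.
have f1 : flag 1 (vec4 0 0 1 0) by apply/flag1P; do 3!eexists.
rewrite amul_tri vec4_0 => /(_ f1)/vec4_inj[_ _ _ s0].
have {}s0 : s = 0 by rewrite -[RHS]s0; ring.
have {}f1 : flag 1 (vec4 0 1 0 0) by apply/flag1P; do 3!eexists.
have := N (vec4 0 0 1 0) (vec4 0 1 0 0) f2 f1.
rewrite amul_tri vec4_0 => /vec4_inj[_ _ _ m0].
have {}m0 : m = 0 by rewrite -[RHS]m0; ring.
exists c, q, p', q', (u / c), (v / c), w, a, b.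
rewrite p0 s0 m0; apply: tri_alg41 => //.
by move: E'; rewrite p0 s0 m0 subr0 => ->; ring.
Qed.

Lemma alg43P nu : flag_alg nu -> terminal_algebra nu -> ~ square_plane nu ->
  flags_annihilate 2 1 nu -> flags_annihilate 1 2 nu ->
  exists c q p' q' u v p a (b : K), nu = alg43 c q p' q' u v p a b.
Proof.
move=> fnu T nsq N N'.
have [c [a [b [p [p' [q [q' [r' [u [v [w [m [s [c0 E E']]]]]]]]]]]]]] :=
  flag_alg_normal fnu T nsq.
subst nu.
have f2 : flag 2 (vec4 0 0 1 0) by apply/flag2P; do 2!eexists.
have := N (vec4 0 0 1 0) (vec4 0 0 1 0) f2.
have f1 : flag 1 (vec4 0 0 1 0) by apply/flag1P; do 3!eexists.
rewrite amul_tri vec4_0 => /(_ f1)/vec4_inj[_ _ _ s0].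
have {}s0 : s = 0 by rewrite -[RHS]s0; ring.
have {}f1 : flag 1 (vec4 0 1 0 0) by apply/flag1P; do 3!eexists.
have := N (vec4 0 0 1 0) (vec4 0 1 0 0) f2 f1.
rewrite amul_tri vec4_0 => /vec4_inj[_ _ _ m0].
have {}m0 : m = 0 by rewrite -[RHS]m0; ring.
have := N' (vec4 0 1 0 0) (vec4 0 0 1 0) f1 f2.
rewrite amul_tri vec4_0 => /vec4_inj[_ _ _ w0].
have {}w0 : w = 0 by rewrite -[RHS]w0; ring.
exists c, q, p', q', (u / c), (v / c), p, a, b.
rewrite w0 s0 m0; apply: tri_alg43 => //.
by move: E'; rewrite w0 s0 m0 => ->; ring.
Qed.

End Flags.

(** * Dense polynomial parametrizations *)

Section BigCell.
Variable K : numFieldType.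
Implicit Types (b g : 'M[K]_4).

(** The inverse of [upperV] written out. The parameters are the plain entries of [upperV], since
    that matrix does the elimination. *)
Definition upper x y z s1 s2 s3 : 'M[K]_4 :=
  mx4 1 s1 (s1 * y + s2) (s1 * (y * x + z) + s2 * x + s3)
      0 1 y (y * x + z)
      0 0 1 x
      0 0 0 1.

Definition upperV x y z s1 s2 s3 : 'M[K]_4 :=
  mx4 1 (- s1) (- s2) (- s3) 0 1 (- y) (- z) 0 0 1 (- x) 0 0 0 1.

Lemma upperVK x y z s1 s2 s3 : upper x y z s1 s2 s3 *m upperV x y z s1 s2 s3 = 1%:M.
Proof.
apply: mx4_eq => v; rewrite -mulmxA mul1mx.
have [? [? [? [? ->]]]] := vec4P v; rewrite !mul_mx4_vec4.
by congr vec4; ring.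
Qed.

Lemma upper_unit x y z s1 s2 s3 : upper x y z s1 s2 s3 \in unitmx.
Proof. by have [] := mulmx1_unit (upperVK x y z s1 s2 s3). Qed.

Definition minor2 g i j k l := g i k * g j l - g i l * g j k.

Definition minor3 g (i j k : 'I_4) : K :=
  let m i j k := g i (inord 1) * minor2 g j k (inord 2) (inord 3) in
  m i j k - m j i k + m k i j.

(** The product of the lower right corner minors of sizes 1, 2, 3. For invertible g, its
    nonvanishing describes the big cell: products of an upper unipotent and a lower triangular
    matrix. *)
Definition pivots g :=
  g (inord 3) (inord 3) * minor2 g (inord 2) (inord 3) (inord 2) (inord 3)
  * minor3 g (inord 1) (inord 2) (inord 3).

Lemma mx4P g : exists a11 a12 a13 a14 a21 a22 a23 a24
                a31 a32 a33 a34 a41 a42 a43 a44,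
  g = mx4 a11 a12 a13 a14 a21 a22 a23 a24 a31 a32 a33 a34 a41 a42 a43 a44.
Proof.
do 16!eexists; apply/matrixP; apply: ord4_ind; apply: ord4_ind;
  by rewrite mxE !inordK //=; reflexivity.
Qed.

Lemma upperV_mul x y z s1 s2 s3 a11 a12 a13 a14 a21 a22 a23 a24
    a31 a32 a33 a34 a41 a42 a43 a44 :
  upperV x y z s1 s2 s3
    *m mx4 a11 a12 a13 a14 a21 a22 a23 a24 a31 a32 a33 a34 a41 a42 a43 a44
  = mx4 (a11 - s1 * a21 - s2 * a31 - s3 * a41) (a12 - s1 * a22 - s2 * a32 - s3 * a42)
        (a13 - s1 * a23 - s2 * a33 - s3 * a43) (a14 - s1 * a24 - s2 * a34 - s3 * a44)
        (a21 - y * a31 - z * a41) (a22 - y * a32 - z * a42)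
        (a23 - y * a33 - z * a43) (a24 - y * a34 - z * a44)
        (a31 - x * a41) (a32 - x * a42) (a33 - x * a43) (a34 - x * a44)
        a41 a42 a43 a44.
Proof.
apply: mx4_eq => v; rewrite -mulmxA.
have [? [? [? [? ->]]]] := vec4P v; rewrite !mul_mx4_vec4.
by congr vec4; ring.
Qed.

Lemma pivots_mx4 a11 a12 a13 a14 a21 a22 a23 a24
    a31 a32 a33 a34 a41 a42 a43 a44 :
  pivots (mx4 a11 a12 a13 a14 a21 a22 a23 a24 a31 a32 a33 a34 a41 a42 a43 a44)
  = a44 * (a33 * a44 - a34 * a43) *
    (a22 * (a33 * a44 - a34 * a43) - a32 * (a23 * a44 - a24 * a43)
     + a42 * (a23 * a34 - a24 * a33)).
Proof. by rewrite /pivots /minor3 /minor2 !mxE !inordK. Qed.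

(** Clearing each row above the diagonal is a linear system whose determinant is a corner minor; the
    witnesses are given by Cramer's rule. *)
Lemma big_cell_full g : pivots g != 0 -> exists x y z s1 s2 s3,
  forall k, flag_stable k (upperV x y z s1 s2 s3 *m g).
Proof.
have [a11 [a12 [a13 [a14 [a21 [a22 [a23 [a24
    [a31 [a32 [a33 [a34 [a41 [a42 [a43 [a44 ->]]]]]]]]]]]]]]]] := mx4P g.
rewrite pivots_mx4 !mulf_eq0 !negb_or => /andP[/andP[n1 n2] n3].
set m2 := (X in X != 0) in n2; set m3 := (X in X != 0) in n3.
pose det3 (a b c d e f g h i : K) :=
  a * (e * i - f * h) - d * (b * i - c * h) + g * (b * f - c * e).
exists (a34 / a44), ((a23 * a44 - a24 * a43) / m2),
  ((a24 * a33 - a34 * a23) / m2), (det3 a12 a13 a14 a32 a33 a34 a42 a43 a44 / m3),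
  (det3 a22 a23 a24 a12 a13 a14 a42 a43 a44 / m3),
  (det3 a22 a23 a24 a32 a33 a34 a12 a13 a14 / m3).
move=> k; rewrite upperV_mul.
set b := mx4 _ _ _ _ _ _ _ _ _ _ _ _ _ _ _ _.
suff [c11 [c21 [c31 [c41 [c22 [c32 [c42 [c33 [c43 [c44 ->]]]]]]]]]] :
    exists c11 c21 c31 c41 c22 c32 c42 c33 c43 c44,
      b = lt4 c11 c21 c31 c41 c22 c32 c42 c33 c43 c44.
  exact: flag_stable_lt4.
do 10!eexists; rewrite /b /lt4; congr mx4; try reflexivity.
all: rewrite /det3 /m3 /m2; field; rewrite ?n1 ?n2 ?n3 //.
Qed.

(** The entries (1,2) and (2,1) may survive, so the first two rows are cleared in the last two
    columns only, by the same 2 by 2 system. *)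
Lemma big_cell_plane g : pivots g != 0 -> exists x y z s2 s3,
  forall k, (1 < k)%N -> flag_stable k (upperV x y z 0 s2 s3 *m g).
Proof.
have [a11 [a12 [a13 [a14 [a21 [a22 [a23 [a24
    [a31 [a32 [a33 [a34 [a41 [a42 [a43 [a44 ->]]]]]]]]]]]]]]]] := mx4P g.
rewrite pivots_mx4 !mulf_eq0 !negb_or => /andP[/andP[n1 n2] _].
set m2 := (X in X != 0) in n2.
exists (a34 / a44), ((a23 * a44 - a24 * a43) / m2),
  ((a24 * a33 - a34 * a23) / m2), ((a13 * a44 - a14 * a43) / m2),
  ((a14 * a33 - a34 * a13) / m2).
move=> k; rewrite upperV_mul.
set b := mx4 _ _ _ _ _ _ _ _ _ _ _ _ _ _ _ _.
suff [c11 [c12 [c21 [c22 [c31 [c32 [c33 [c41 [c42 [c43 [c44 ->]]]]]]]]]]] :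
    exists c11 c12 c21 c22 c31 c32 c33 c41 c42 c43 c44,
      b = mx4 c11 c12 0 0 c21 c22 0 0 c31 c32 c33 0 c41 c42 c43 c44.
  exact: flag_stable_block.
do 11!eexists; rewrite /b; congr mx4; try reflexivity.
all: rewrite /m2; field; rewrite ?n1 ?n2 //.
Qed.

Definition mx_of (I : finType) (h : affine K ('I_4 * 'I_4 + I)%type) : 'M[K]_4 :=
  \matrix_(i, j) h (inl (i, j)).

Lemma pfun_pivots (I : finType) : pfun (fun h => pivots (@mx_of I h)).
Proof.
have pe i j : pfun (fun h => @mx_of I h i j).
  by under eq_fun do rewrite mxE; apply: pfun_coord.
have pm i j k l : pfun (fun h => minor2 (@mx_of I h) i j k l).
  by apply: pfun_sub; apply: pfun_mul.
by rewrite /pivots /minor3; solve_pfun.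
Qed.

End BigCell.

(** * From the big cell to the whole general linear group *)

Section Density.
Variable K : numClosedFieldType.

(* The action [mx_act g (\adj g)] is polynomial in g, and differs from
   [gl_act g] by a scaling of g. *)
Lemma closed_of_generic_gl (I : finType) (M : affine K I -> algebra_structure K 4)
    (q : affine K I -> K) t1 (Z : set (algebra_structure K 4)) :
  polymap M -> pfun q -> q t1 != 0 -> zariski_closed Z ->
  (forall g, g \in unitmx -> pivots g != 0 ->
    forall (k : K) t, k != 0 -> q t != 0 -> Z (gl_act (k *: g) (M t))) ->
  forall g t, g \in unitmx -> Z (gl_act g (M t)).
Proof.
move=> pM pq q1 clZ H.
pose par (h : affine K ('I_4 * 'I_4 + I)%type) : affine K I := [ffun i => h (inr i)].
have ppar : polymap par.
  by move=> i; under eq_fun do rewrite ffunE; apply: pfun_coord.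
pose psi h := mx_act (mx_of h) (\adj (mx_of h)) (M (par h)).
pose encode (g : 'M[K]_4) (t : affine K I) : affine K ('I_4 * 'I_4 + I)%type :=
  [ffun s => match s with inl ij => g ij.1 ij.2 | inr i => t i end].
have mx_encode g t : mx_of (encode g t) = g.
  by apply/matrixP => i j; rewrite mxE ffunE.
have par_encode g t : par (encode g t) = t.
  by apply/ffunP => i; rewrite !ffunE.
have pmx_of : pmx (fun h => @mx_of K I h).
  by move=> i j; under eq_fun do rewrite mxE; apply: pfun_coord.
have Zpsi : forall h, Z (psi h).
  apply: (@closed_of_generic _ _ _ psi
    (fun h => \det (mx_of h) * pivots (mx_of h) * q (par h))
    (encode 1%:M t1)) => //.
  - apply: polymap_mx_act => //; last exact: pmx_adj.
    by move=> i; apply: (pfun_comp (pM i)).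
  - apply: pfun_mul; last exact: (pfun_comp pq).
    by apply: pfun_mul; [apply: pfun_det|apply: pfun_pivots].
  - rewrite mx_encode par_encode det1 mul1r mulf_neq0 //.
    rewrite /pivots /minor3 /minor2 !mxE -!val_eqE /= !inordK //=.
    by rewrite !(mulr1, mul1r, mulr0, subr0, addr0) oner_neq0.
  move=> h; rewrite 2!mulf_eq0 2!negb_or => /andP[/andP[d0 p0] qh].
  have hu : mx_of h \in unitmx by rewrite unitmxE unitfE.
  have k0 : \det (mx_of h) ^- 2 != 0 by rewrite invr_eq0 expf_neq0.
  by rewrite /psi gl_act_adj //; apply: H.
move=> g t gu; have d0 : \det g != 0 by rewrite -unitfE -unitmxE.
(* The adjugate action of l g is the true action of g up to the scale l^-7 (det g)^-2, which is 1
   for l = r^-2 with r^7 = det g. *)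
have [l l0 El] : exists2 l, l != 0 & (l ^+ 4 * \det g) ^- 2 * l = 1.
  have [r Er] : exists r : K, r ^+ 7 = \det g.
    by exists (7.-root (\det g)); rewrite rootCK.
  have r0 : r != 0 by apply: contra d0 => /eqP r0; rewrite -Er r0 expr0n.
  exists (r ^- 2); first by rewrite invr_eq0 expf_neq0.
  by rewrite -Er; field.
have := Zpsi (encode (l *: g) t); rewrite /psi mx_encode par_encode.
have lgu : l *: g \in unitmx by rewrite unitmxZ ?unitfE.
by rewrite gl_act_adj // detZ scalerA El scale1r.
Qed.

End Density.

(** * Closed conditions, and the closures inside the variety *)

Section ClosedConditions.
Variable K : numFieldType.
Implicit Types (mu nu : algebra_structure K 4).

Lemma zariski_closed_vec I n (v : affine K I -> 'cV[K]_n) :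
  pmx v -> zariski_closed [set mu | v mu = 0].
Proof.
move=> pv; have -> : [set mu | v mu = 0] = [set mu | forall i, v mu i 0 = 0].
  apply/seteqP; split=> mu /= E; first by move=> i; rewrite E mxE.
  by apply/colP => i; rewrite E mxE.
by apply: zariski_closed_all => i; apply: zariski_closed_zero.
Qed.

Lemma zariski_closed_terminal : zariski_closed [set mu | @terminal_algebra K 4 mu].
Proof.
apply: zariski_closed_all => a; apply: zariski_closed_all => x.
apply: zariski_closed_all => y; apply: zariski_closed_all => z.
apply: (@zariski_closed_vec _ _ (fun mu : algebra_structure K 4 => _)).
rewrite /terminal_defect.
by repeat first [exact: pmx_const | exact: polymap_id | apply: pmx_add
  | apply: pmx_opp | apply: pmx_amul].
Qed.

Lemma zariski_closed_word : zariski_closed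
  [set mu : algebra_structure K 4 |
    forall s x, size s = 4 -> mul_word mu s x = 0].
Proof.
apply: zariski_closed_all => s; apply: zariski_closed_all => x.
apply: zariski_closed_all => _.
apply: (@zariski_closed_vec _ _ (fun mu : algebra_structure K 4 => _)).
elim: s => [|[[] y] s IHs] /=; first exact: pmx_const.
  by apply: pmx_amul => //; [exact: polymap_id|exact: pmx_const].
by apply: pmx_amul => //; [exact: polymap_id|exact: pmx_const].
Qed.

(** Each letter raises the flag level by one, and level 4 is zero. *)
Lemma flag_alg_word mu s x : flag_alg mu -> size s = 4 -> mul_word mu s x = 0.
Proof.
move=> fmu s4; have : flag (size s) (mul_word mu s x).
  elim: s {s4} => [|[b y] s IHs] //=.
  by have [xy yx] := fmu _ _ y IHs; case: b.
by rewrite s4 => f; apply/colP => i; rewrite f ?mxE.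
Qed.

Lemma terminal_D01 lambda alpha beta : terminal_algebra (@D01 K lambda alpha beta).
Proof.
move=> a x y z; rewrite D01E.
have [? [? [? [? ->]]]] := vec4P a; have [? [? [? [? ->]]]] := vec4P x.
have [? [? [? [? ->]]]] := vec4P y; have [? [? [? [? ->]]]] := vec4P z.
by rewrite /terminal_defect !(amul_tri, vec4lin); congr vec4; ring.
Qed.

Lemma terminal_T41 alpha : terminal_algebra (@T41 K alpha).
Proof.
move=> a x y z; rewrite T41E.
have [? [? [? [? ->]]]] := vec4P a; have [? [? [? [? ->]]]] := vec4P x.
have [? [? [? [? ->]]]] := vec4P y; have [? [? [? [? ->]]]] := vec4P z.
by rewrite /terminal_defect !(amul_tri, vec4lin); congr vec4; ring.
Qed.

Lemma terminal_T43 lambda alpha : terminal_algebra (@T43 K lambda alpha).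
Proof.
move=> a x y z; rewrite T43E.
have [? [? [? [? ->]]]] := vec4P a; have [? [? [? [? ->]]]] := vec4P x.
have [? [? [? [? ->]]]] := vec4P y; have [? [? [? [? ->]]]] := vec4P z.
by rewrite /terminal_defect !(amul_tri, vec4lin); congr vec4; ring.
Qed.

Lemma family_closure_terminal F :
  (forall mu, F mu -> flag_alg mu /\ terminal_algebra mu) ->
  family_closure F `<=` nilpotent_terminal K 4.
Proof.
move=> HF; suff sub : family_closure F `<=` [set mu | (forall s x, size s = 4 ->
    mul_word mu s x = 0) /\ terminal_algebra mu].
  by move=> mu /sub[w0 T]; split=> //; apply: word_nilpotent w0.
apply: family_closure_sub.
  apply: zariski_closed_and zariski_closed_word zariski_closed_terminal.
move=> g mu gu /HF[fmu T]; split; last exact: terminal_gl_act.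
move=> s x s4; rewrite mul_word_gl_act // flag_alg_word ?mulmx0 //.
by rewrite size_map.
Qed.

Lemma closure_D01_sub : family_closure (D01_family K) `<=` nilpotent_terminal K 4.
Proof.
apply: family_closure_terminal => _ [la [al [be ->]]].
by split; [rewrite D01E; apply: flag_tri|apply: terminal_D01].
Qed.

Lemma closure_T41_sub : family_closure (T41_family K) `<=` nilpotent_terminal K 4.
Proof.
apply: family_closure_terminal => _ [al ->].
by split; [rewrite T41E; apply: flag_tri|apply: terminal_T41].
Qed.

Lemma closure_T43_sub : family_closure (T43_family K) `<=` nilpotent_terminal K 4.
Proof.
apply: family_closure_terminal => _ [la [al ->]].
by split; [rewrite T43E; apply: flag_tri|apply: terminal_T43].
Qed.

End ClosedConditions.

(** * The three parametrizations and their density *)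

Section Parametrizations.
Variable K : numClosedFieldType.
Implicit Types (mu nu : algebra_structure K 4).

Definition cell x y z s1 s2 s3 mu :=
  mx_act (upper x y z s1 s2 s3) (upperV x y z s1 s2 s3) mu.

Lemma cellE x y z s1 s2 s3 mu :
  cell x y z s1 s2 s3 mu = gl_act (upper x y z s1 s2 s3) mu.
Proof. by rewrite (gl_act_mx_act _ (upperVK x y z s1 s2 s3)). Qed.

Lemma cell_gl g x y z s1 s2 s3 mu : g \in unitmx ->
  gl_act g mu = cell x y z s1 s2 s3 (gl_act (upperV x y z s1 s2 s3 *m g) mu).
Proof.
move=> gu; rewrite cellE; have [u1 u2] := mulmx1_unit (upperVK x y z s1 s2 s3).
by rewrite gl_actM ?unitmx_mul ?u2 // mulmxA upperVK mul1mx.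
Qed.

Lemma pmx_mx4 (I : finType) (a11 a12 a13 a14 a21 a22 a23 a24
    a31 a32 a33 a34 a41 a42 a43 a44 : affine K I -> K) :
  pfun a11 -> pfun a12 -> pfun a13 -> pfun a14 ->
  pfun a21 -> pfun a22 -> pfun a23 -> pfun a24 ->
  pfun a31 -> pfun a32 -> pfun a33 -> pfun a34 ->
  pfun a41 -> pfun a42 -> pfun a43 -> pfun a44 ->
  pmx (fun t => mx4 (a11 t) (a12 t) (a13 t) (a14 t) (a21 t) (a22 t) (a23 t)
    (a24 t) (a31 t) (a32 t) (a33 t) (a34 t) (a41 t) (a42 t) (a43 t) (a44 t)).
Proof.
move=> ? ? ? ? ? ? ? ? ? ? ? ? ? ? ? ?; apply: ord4_ind; apply: ord4_ind;
  by under eq_fun do rewrite mxE !inordK //=.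
Qed.

Lemma polymap_cell (I : finType) (x y z s1 s2 s3 : affine K I -> K)
    (mu : affine K I -> algebra_structure K 4) :
  pfun x -> pfun y -> pfun z -> pfun s1 -> pfun s2 -> pfun s3 -> polymap mu ->
  polymap (fun t => cell (x t) (y t) (z t) (s1 t) (s2 t) (s3 t) (mu t)).
Proof.
by move=> *; apply: polymap_mx_act => //; apply: pmx_mx4; solve_pfun.
Qed.

(** Nine structure constants and six coordinates on the open cell of the variety of full flags. *)
Definition param41 (t : affine K 'I_15) :=
  cell (t (inord 9)) (t (inord 10)) (t (inord 11)) (t (inord 12)) (t (inord 13))
    (t (inord 14))
    (alg41 (t (inord 0)) (t (inord 1)) (t (inord 2)) (t (inord 3)) (t (inord 4))
      (t (inord 5)) (t (inord 6)) (t (inord 7)) (t (inord 8))).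

Definition param43 (t : affine K 'I_15) :=
  cell (t (inord 9)) (t (inord 10)) (t (inord 11)) (t (inord 12)) (t (inord 13))
    (t (inord 14))
    (alg43 (t (inord 0)) (t (inord 1)) (t (inord 2)) (t (inord 3)) (t (inord 4))
      (t (inord 5)) (t (inord 6)) (t (inord 7)) (t (inord 8))).

(** Twelve structure constants and five coordinates of a line in a plane; [s1] is 0 because mixing
    e1 and e2 keeps the form [algD]. *)
Definition paramD (t : affine K 'I_17) :=
  cell (t (inord 12)) (t (inord 13)) (t (inord 14)) 0 (t (inord 15))
    (t (inord 16))
    (algD (t (inord 0)) (t (inord 1)) (t (inord 2)) (t (inord 3)) (t (inord 4))
      (t (inord 5)) (t (inord 6)) (t (inord 7)) (t (inord 8)) (t (inord 9))
      (t (inord 10)) (t (inord 11))).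

Lemma polymap_param41 : polymap param41.
Proof. by apply: polymap_cell; solve_pfun; apply: polymap_tri; solve_pfun. Qed.

Lemma polymap_param43 : polymap param43.
Proof. by apply: polymap_cell; solve_pfun; apply: polymap_tri; solve_pfun. Qed.

Lemma polymap_paramD : polymap paramD.
Proof. by apply: polymap_cell; solve_pfun; apply: polymap_tri; solve_pfun. Qed.

Lemma upperV_unit x y z s1 s2 s3 : upperV x y z s1 s2 s3 \in @unitmx K 4.
Proof. by have [] := mulmx1_unit (upperVK x y z s1 s2 s3). Qed.

(** For g in the big cell, [upperV *m g] preserves the flag, so it sends [alg41] with c <> 0 to a
    structure that [alg41P] recognises; [upper] then moves the flag back. *)
Lemma closure_T41_param :
  family_closure (T41_family K) = zariski_closure (range param41).
Proof.
apply/seteqP; split; last first.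
  apply: zariski_closure_sub; first exact: family_closure_closed.
  move=> _ [t _ <-]; rewrite /param41 cellE.
  by apply: family_closure_gl (upper_unit _ _ _ _ _ _) _; apply: alg41_closure.
apply: family_closure_sub; first exact: zariski_closure_closed.
pose M (t : affine K 'I_9) := alg41 (t (inord 0)) (t (inord 1)) (t (inord 2))
  (t (inord 3)) (t (inord 4)) (t (inord 5)) (t (inord 6)) (t (inord 7))
  (t (inord 8)).
suff H g t : g \in unitmx -> zariski_closure (range param41) (gl_act g (M t)).
  (* At these values q(u + v/3) - aw = 0, as e2e2 = 0 in T41 demands. *)
  move=> g _ gu [al ->]; have := H g (vals 9 [:: 1; 1; al; 0; -1; 3; 1; 0; 0]) gu.
  rewrite /M !ffunE !inordK //= T41E; congr (zariski_closure _ (gl_act g _)).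
  by rewrite /alg41; congr tri; field.
move: g t; apply: (@closed_of_generic_gl _ _ M (fun t => t (inord 0)) [ffun=> 1]).
- by apply: polymap_tri; solve_pfun.
- exact: pfun_coord.
- by rewrite ffunE oner_neq0.
- exact: zariski_closure_closed.
move=> g gu /big_cell_full[x [y [z [s1 [s2 [s3 bs]]]]]] k t k0 c0.
have kgu : k *: g \in unitmx by rewrite unitmxZ ?unitfE.
rewrite (cell_gl x y z s1 s2 s3) //.
set b := upperV _ _ _ _ _ _ *m _.
have bu : b \in unitmx by rewrite unitmx_mul upperV_unit.
have {}bs j : flag_stable j b.
  move=> v /bs fv i ij; rewrite /b -scalemxAr -scalemxAl mxE fv ?mulr0 //.
have [] := @alg41P _ (gl_act b (M t)).
- by apply: flag_alg_gl => //; apply: flag_tri.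
- by apply: terminal_gl_act => //; have [] := closure_T41_sub (alg41_closure
    (t (inord 0)) (t (inord 1)) (t (inord 2))
    (t (inord 3)) (t (inord 4)) (t (inord 5)) (t (inord 6)) (t (inord 7))
    (t (inord 8))).
- move/(square_plane_gl bu (bs _))/(_ (vec4 1 0 0 0) (vec4 1 0 0 0)).
  rewrite amul_tri => /flag2P[? [? /vec4_inj[_ /eqP + _ _]]].
  by rewrite !mulr1 (negbTE c0).
- apply: left_inner_line_gl => // u v w.
  have [? [? [? [? ->]]]] := vec4P u; have [? [? [? [? ->]]]] := vec4P v.
  have [? [? [? [? ->]]]] := vec4P w; rewrite !amul_tri.
  by apply/flag3P; eexists; congr vec4; ring.
- apply: flags_annihilate_gl => // _ _ /flag2P[? [? ->]] /flag1P[? [? [? ->]]].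
  by rewrite amul_tri vec4_0; congr vec4; ring.
move=> c [q [p' [q' [u [v [w [a [b' ->]]]]]]]].
apply: subset_zariski_closure.
exists (vals 15 [:: c; q; p'; q'; u; v; w; a; b'; x; y; z; s1; s2; s3]) => //.
by rewrite /param41 !ffunE !inordK.
Qed.

Lemma closure_T43_param :
  family_closure (T43_family K) = zariski_closure (range param43).
Proof.
apply/seteqP; split; last first.
  apply: zariski_closure_sub; first exact: family_closure_closed.
  move=> _ [t _ <-]; rewrite /param43 cellE.
  by apply: family_closure_gl (upper_unit _ _ _ _ _ _) _; apply: alg43_closure.
apply: family_closure_sub; first exact: zariski_closure_closed.
pose M (t : affine K 'I_9) := alg43 (t (inord 0)) (t (inord 1)) (t (inord 2))
  (t (inord 3)) (t (inord 4)) (t (inord 5)) (t (inord 6)) (t (inord 7))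
  (t (inord 8)).
suff H g t : g \in unitmx -> zariski_closure (range param43) (gl_act g (M t)).
  move=> g _ gu [la [al ->]].
  (* With q = 1, e2e2 is u + (1 - la) al, which is 1 for this u. *)
  have := H g (vals 9 [:: 1; 1; 0; 0; al * (la - 1) + 1; 3 * al; la; 0; 0]) gu.
  rewrite /M !ffunE !inordK //= T43E; congr (zariski_closure _ (gl_act g _)).
  by rewrite /alg43; congr tri; field.
move: g t; apply: (@closed_of_generic_gl _ _ M (fun t => t (inord 0)) [ffun=> 1]).
- by apply: polymap_tri; solve_pfun.
- exact: pfun_coord.
- by rewrite ffunE oner_neq0.
- exact: zariski_closure_closed.
move=> g gu /big_cell_full[x [y [z [s1 [s2 [s3 bs]]]]]] k t k0 c0.
have kgu : k *: g \in unitmx by rewrite unitmxZ ?unitfE.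
rewrite (cell_gl x y z s1 s2 s3) //.
set b := upperV _ _ _ _ _ _ *m _.
have bu : b \in unitmx by rewrite unitmx_mul upperV_unit.
have {}bs j : flag_stable j b.
  move=> v /bs fv i ij; rewrite /b -scalemxAr -scalemxAl mxE fv ?mulr0 //.
have [] := @alg43P _ (gl_act b (M t)).
- by apply: flag_alg_gl => //; apply: flag_tri.
- by apply: terminal_gl_act => //; have [] := closure_T43_sub (alg43_closure
    (t (inord 0)) (t (inord 1)) (t (inord 2))
    (t (inord 3)) (t (inord 4)) (t (inord 5)) (t (inord 6)) (t (inord 7))
    (t (inord 8))).
- move/(square_plane_gl bu (bs _))/(_ (vec4 1 0 0 0) (vec4 1 0 0 0)).
  rewrite amul_tri => /flag2P[? [? /vec4_inj[_ /eqP + _ _]]].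
  by rewrite !mulr1 (negbTE c0).
- apply: flags_annihilate_gl => // _ _ /flag2P[? [? ->]] /flag1P[? [? [? ->]]].
  by rewrite amul_tri vec4_0; congr vec4; ring.
- apply: flags_annihilate_gl => // _ _ /flag1P[? [? [? ->]]] /flag2P[? [? ->]].
  by rewrite amul_tri vec4_0; congr vec4; ring.
move=> c [q [p' [q' [u [v [p [a [b' ->]]]]]]]].
apply: subset_zariski_closure.
exists (vals 15 [:: c; q; p'; q'; u; v; p; a; b'; x; y; z; s1; s2; s3]) => //.
by rewrite /param43 !ffunE !inordK.
Qed.

Lemma closure_D01_param :
  family_closure (D01_family K) = zariski_closure (range paramD).
Proof.
apply/seteqP; split; last first.
  apply: zariski_closure_sub; first exact: family_closure_closed.
  move=> _ [t _ <-]; rewrite /paramD cellE.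
  by apply: family_closure_gl (upper_unit _ _ _ _ _ _) _; apply: algD_closure.
apply: family_closure_sub; first exact: zariski_closure_closed.
pose M (t : affine K 'I_12) := algD (t (inord 0)) (t (inord 1)) (t (inord 2))
  (t (inord 3)) (t (inord 4)) (t (inord 5)) (t (inord 6)) (t (inord 7))
  (t (inord 8)) (t (inord 9)) (t (inord 10)) (t (inord 11)).
suff H g t : g \in unitmx -> zariski_closure (range paramD) (gl_act g (M t)).
  move=> g _ gu [la [al [be ->]]].
  have := H g (vals 12 [:: la; 1; 0; 0; 1; 0; 1; 0; al; 1; be; 0]) gu.
  by rewrite /M !ffunE !inordK //= D01E.
move: g t; apply: (@closed_of_generic_gl _ _ M (fun=> 1) [ffun=> 1]).
- by apply: polymap_tri; solve_pfun.
- exact: pfun_const.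
- by rewrite oner_neq0.
- exact: zariski_closure_closed.
move=> g gu /big_cell_plane[x [y [z [s2 [s3 bs]]]]] k t k0 _.
have kgu : k *: g \in unitmx by rewrite unitmxZ ?unitfE.
rewrite (cell_gl x y z 0 s2 s3) //.
set b := upperV _ _ _ _ _ _ *m _.
have bu : b \in unitmx by rewrite unitmx_mul upperV_unit.
have {}bs j : (1 < j)%N -> flag_stable j b.
  move=> j1 v /(bs _ j1) fv i ij.
  by rewrite /b -scalemxAr -scalemxAl mxE fv ?mulr0.
have [] := @plane_algP _ (gl_act b (M t)).
  by apply: plane_alg_gl => //; [apply: bs|apply: bs|apply: plane_alg_algD].
move=> c3 [c4 [p [p' [q [q' [r [r' [u [v [w [m ->]]]]]]]]]]].
apply: subset_zariski_closure.
exists (vals 17 [:: c3; c4; p; p'; q; q'; r; r'; u; v; w; m; x; y; z; s2; s3]) => //.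
by rewrite /paramD !ffunE !inordK.
Qed.

End Parametrizations.

(** * Chains of irreducible closed subsets *)

Section Chains.
Variable K : numClosedFieldType.

Definition coef i j k (nu : algebra_structure K 4) :=
  nu (inord i, inord j, inord k).

Definition coef_minor k l i j i' j' (nu : algebra_structure K 4) :=
  coef i j k nu * coef i' j' l nu - coef i j l nu * coef i' j' k nu.

(** The determinant of the first three coordinates of e1e1, e1e2 and e2e1. *)
Definition coef_det (nu : algebra_structure K 4) :=
  coef 0 0 0 nu * coef_minor 1 2 0 1 1 0 nu
  - coef 0 1 0 nu * coef_minor 1 2 0 0 1 0 nu
  + coef 1 0 0 nu * coef_minor 1 2 0 0 0 1 nu.

(** The first nine read off the structure constants. With coordinates numbered from 0, every product
    satisfies coord0 = s1 coord1 + s2 coord2 + s3 coord3, and while the s_i are 0, e1e2 and e2e1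
    satisfy coord1 = y coord2 + z coord3. Hence a coordinate, a 2 by 2 minor or a 3 by 3 determinant
    vanishes until the next flag parameter is switched on. *)
Definition separators41 : seq (algebra_structure K 4 -> K) :=
  [:: coef 0 0 1; coef 1 0 2; coef 0 1 3; coef 1 0 3; coef 0 2 3; coef 2 0 3;
      coef 1 2 3; coef 0 0 2; coef 0 0 3; coef 0 2 2; coef 1 0 1;
      coef_minor 1 2 1 0 0 1; coef 0 0 0; coef_minor 0 1 0 0 0 1; coef_det].

Definition separators43 : seq (algebra_structure K 4 -> K) :=
  [:: coef 0 0 1; coef 1 0 2; coef 0 1 3; coef 1 0 3; coef 0 2 3; coef 2 0 3;
      coef 0 1 2; coef 0 0 2; coef 0 0 3; coef 0 2 2; coef 1 0 1;
      coef_minor 1 2 1 0 0 1; coef 0 0 0; coef_minor 0 1 0 0 0 1; coef_det].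

Definition separatorsD : seq (algebra_structure K 4 -> K) :=
  [:: coef 0 0 2; coef 0 0 3; coef 0 1 2; coef 0 1 3; coef 1 0 2; coef 1 0 3;
      coef 1 1 2; coef 1 1 3; coef 0 2 3; coef 2 0 3; coef 1 2 3; coef 2 1 3;
      coef 0 2 2; coef 0 0 1; coef_minor 1 2 0 0 0 1; coef 0 0 0;
      coef_minor 0 2 0 0 0 1].

Lemma pfun_coef i j k : pfun (coef i j k).
Proof. exact: pfun_coord. Qed.

Lemma pfun_coef_minor k l i j i' j' : pfun (coef_minor k l i j i' j').
Proof. by rewrite /coef_minor; solve_pfun; apply: pfun_coef. Qed.

Lemma pfun_coef_det : pfun coef_det.
Proof.
by rewrite /coef_det; solve_pfun; first [apply: pfun_coef|apply: pfun_coef_minor].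
Qed.

Lemma coef_cell i j k x y z s1 s2 s3 nu :
  coef i j k (cell x y z s1 s2 s3 nu)
  = (upper x y z s1 s2 s3 *m amul nu
      (upperV x y z s1 s2 s3 *m delta_mx (inord i) 0)
      (upperV x y z s1 s2 s3 *m delta_mx (inord j) 0)) (inord k) 0.
Proof. by rewrite /coef -amul_delta amul_mx_act. Qed.

(** [f] lists the columns of [upperV]; the final list is [upper] applied to t, whose coordinate 0
    vanishes. *)
Lemma coef_cell_tri i j k x y z s1 s2 s3 c2 c3 c4 p p' q q' r r' u v w m s :
  coef i j k (cell x y z s1 s2 s3 (tri c2 c3 c4 p p' q q' r r' u v w m s))
  = let f l := nth 0 [:: vec4 1 0 0 0; vec4 (- s1) 1 0 0; vec4 (- s2) (- y) 1 0;
      vec4 (- s3) (- z) (- x) 1] l in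
    let t := amul (tri c2 c3 c4 p p' q q' r r' u v w m s)
      (f (@inord 3 i)) (f (@inord 3 j)) in
    let t1 := t (inord 1) 0 in let t2 := t (inord 2) 0 in
    let t3 := t (inord 3) 0 in
    [:: s1 * t1 + (s1 * y + s2) * t2 + (s1 * (y * x + z) + s2 * x + s3) * t3;
        t1 + y * t2 + (y * x + z) * t3; t2 + x * t3; t3]`_(@inord 3 k).
Proof.
have Ef l : upperV x y z s1 s2 s3 *m delta_mx l 0 =
    [:: vec4 1 0 0 0; vec4 (- s1) 1 0 0; vec4 (- s2) (- y) 1 0;
      vec4 (- s3) (- z) (- x) 1]`_l.
  move: l; apply: ord4_ind; rewrite delta4 !inordK //= mul_mx4_vec4;
    by congr vec4; ring.
have t0 a b : amul (tri c2 c3 c4 p p' q q' r r' u v w m s) a b (inord 0) 0 = 0.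
  have [? [? [? [? ->]]]] := vec4P a; have [? [? [? [? ->]]]] := vec4P b.
  by rewrite amul_tri vec4E.
rewrite coef_cell !Ef; cbv zeta; set t := amul _ _ _.
have {}t0 : t (inord 0) 0 = 0 by apply: t0.
rewrite [in LHS](vec4_eta t) t0 /upper mul_mx4_vec4.
by move: (inord k); apply: ord4_ind; rewrite vec4E !inordK //=; ring.
Qed.

(* Subscripts of [truncate] and [vals] are resolved first, which keeps the
   terms small. *)
Ltac coef_simpl :=
  rewrite !ffunE !inordK //= /coef_det /coef_minor !coef_cell_tri !inordK //=
    !amul_tri !vec4E.

Ltac pfun_separator :=
  first [exact: pfun_coef|exact: pfun_coef_minor|exact: pfun_coef_det].

Ltac separator_neq0 := coef_simpl;
  match goal with |- is_true (?a != 0) => first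
    [ rewrite [a](_ : _ = 1); [exact: oner_neq0 | by ring]
    | rewrite [a](_ : _ = -1); [by rewrite oppr_eq0 oner_eq0 | by ring]
    | rewrite [a](_ : _ = 2); [by rewrite pnatr_eq0 | by ring]
    | rewrite [a](_ : _ = -2); [by rewrite oppr_eq0 pnatr_eq0 | by ring]
    | rewrite [a](_ : _ = 4); [by rewrite pnatr_eq0 | by ring] ] end.

Lemma chain41 : irreducible_chain (family_closure (T41_family K)) 15.
Proof.
apply: (chain_of_param (f := fun i : 'I_15 => nth (fun=> 0) separators41 i)
  (@polymap_param41 K)).
- exact: family_closure_closed.
- by move=> t; rewrite closure_T41_param; apply: subset_zariski_closure; exists t.
- case=> i lti; do 15?[case: i lti => [|i] lti; first by pfun_separator] => //.
- case=> i lti t; rewrite /param41 /alg41.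
  do 15?[case: i lti => [|i] lti; first by coef_simpl; ring] => //.
- case=> i lti; rewrite /param41 /alg41.
  (* At the all-ones point the minor for s2 vanishes by accident; z = 0 avoids this. *)
  exists (vals 15 (if i == 13 then [:: 1; 1; 1; 1; 1; 1; 1; 1; 1; 1; 1; 0; 1; 1]
    else nseq 15 1)).
  do 15?[case: i lti => [|i] lti; first by separator_neq0] => //.
Qed.

Lemma chain43 : irreducible_chain (family_closure (T43_family K)) 15.
Proof.
apply: (chain_of_param (f := fun i : 'I_15 => nth (fun=> 0) separators43 i)
  (@polymap_param43 K)).
- exact: family_closure_closed.
- by move=> t; rewrite closure_T43_param; apply: subset_zariski_closure; exists t.
- case=> i lti; do 15?[case: i lti => [|i] lti; first by pfun_separator] => //.
- case=> i lti t; rewrite /param43 /alg43.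
  do 15?[case: i lti => [|i] lti; first by coef_simpl; ring] => //.
- case=> i lti; rewrite /param43 /alg43.
  (* When all parameters are 1, e1e2 = e2e1, which kills the functions for z and s3 (indices 11 and
     14); there p is set to 0. *)
  exists (vals 15 (if i == 13 then [:: 1; 1; 1; 1; 1; 1; 1; 1; 1; 1; 1; 0; 1; 1]
    else if (i == 11) || (i == 14)
    then [:: 1; 1; 1; 1; 1; 1; 0; 1; 1; 1; 1; 1; 1; 1; 1] else nseq 15 1)).
  do 15?[case: i lti => [|i] lti; first by separator_neq0] => //.
Qed.

Lemma chainD : irreducible_chain (family_closure (D01_family K)) 17.
Proof.
apply: (chain_of_param (f := fun i : 'I_17 => nth (fun=> 0) separatorsD i)
  (@polymap_paramD K)).
- exact: family_closure_closed.
- by move=> t; rewrite closure_D01_param; apply: subset_zariski_closure; exists t.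
- case=> i lti; do 17?[case: i lti => [|i] lti; first by pfun_separator] => //.
- case=> i lti t; rewrite /paramD /algD.
  do 17?[case: i lti => [|i] lti; first by coef_simpl; ring] => //.
- case=> i lti; rewrite /paramD /algD.
  (* When all parameters are 1, e1e1 = e1e2, which kills the minors for z and the last flag
     parameter; there c3 is set to 0. *)
  exists (vals 17 (if (i == 14) || (i == 16) then 0 :: nseq 16 1 else nseq 17 1)).
  do 17?[case: i lti => [|i] lti; first by separator_neq0] => //.
Qed.

Lemma dimension_T41 : has_dimension (family_closure (T41_family K)) 15.
Proof.
split=> [|m]; first exact: chain41.
rewrite closure_T41_param -[X in (_ <= X)%N](card_ord 15).
by apply: (chain_length_le (@polymap_param41 K)).
Qed.

Lemma dimension_T43 : has_dimension (family_closure (T43_family K)) 15.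
Proof.
split=> [|m]; first exact: chain43.
rewrite closure_T43_param -[X in (_ <= X)%N](card_ord 15).
by apply: (chain_length_le (@polymap_param43 K)).
Qed.

Lemma dimension_D01 : has_dimension (family_closure (D01_family K)) 17.
Proof.
split=> [|m]; first exact: chainD.
rewrite closure_D01_param -[X in (_ <= X)%N](card_ord 17).
by apply: (chain_length_le (@polymap_paramD K)).
Qed.

End Chains.

(** * The three components *)

Section Components.
Variable K : numClosedFieldType.
Implicit Types (mu nu : algebra_structure K 4).

Notation ZD := (family_closure (D01_family K)).
Notation ZT41 := (family_closure (T41_family K)).
Notation ZT43 := (family_closure (T43_family K)).

(** In D01, xy lies in the plane of e3 and e4 and (xy)z on the line of e4, which annihilates
    everything. *)
Lemma closure_D01_cube_annihilated nu : ZD nu ->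
  forall x y z t, amul nu (amul nu (amul nu x y) z) t = 0.
Proof.
move: nu; apply: (family_closure_sub (Z := [set nu | forall x y z t,
  amul nu (amul nu (amul nu x y) z) t = 0])).
  do 4![apply: zariski_closed_all => ?]; apply: zariski_closed_vec.
  by repeat first [exact: pmx_const | exact: polymap_id | apply: pmx_amul].
move=> g mu gu [la [al [be ->]]] x y z t; rewrite !amul_gl_act !mulKmx // D01E.
move: (invmx g *m x) (invmx g *m y) (invmx g *m z) (invmx g *m t) => {}x {}y {}z {}t.
have [? [? [? [? ->]]]] := vec4P x; have [? [? [? [? ->]]]] := vec4P y.
have [? [? [? [? ->]]]] := vec4P z; have [? [? [? [? ->]]]] := vec4P t.
rewrite !amul_tri (_ : vec4 _ _ _ _ = 0) ?mulmx0 // [RHS]vec4_0.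
by congr vec4; ring.
Qed.

(** In T43 squares lie in the span of e2, e3, e4 and (zt)u in that of e3, e4, where e2e3 = e3e3 =
    0. *)
Lemma closure_T43_square_cube nu : ZT43 nu ->
  forall x y z t u, amul nu (amul nu x y) (amul nu (amul nu z t) u) = 0.
Proof.
move: nu; apply: (family_closure_sub (Z := [set nu | forall x y z t u,
  amul nu (amul nu x y) (amul nu (amul nu z t) u) = 0])).
  do 5![apply: zariski_closed_all => ?]; apply: zariski_closed_vec.
  by repeat first [exact: pmx_const | exact: polymap_id | apply: pmx_amul].
move=> g mu gu [la [al ->]] x y z t u; rewrite !amul_gl_act !mulKmx // T43E.
move: (invmx g *m x) (invmx g *m y) (invmx g *m z) (invmx g *m t)
  (invmx g *m u) => {}x {}y {}z {}t {}u.
have [? [? [? [? ->]]]] := vec4P x; have [? [? [? [? ->]]]] := vec4P y.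
have [? [? [? [? ->]]]] := vec4P z; have [? [? [? [? ->]]]] := vec4P t.
have [? [? [? [? ->]]]] := vec4P u.
rewrite !amul_tri (_ : vec4 _ _ _ _ = 0) ?mulmx0 // [RHS]vec4_0.
by congr vec4; ring.
Qed.

(** In T41 left multiplication sends the span of e2, e3, e4 to the line of e4, because e1e2 has no
    e3-coordinate and e2e2 = 0. *)
Lemma closure_T41_left_cube nu : ZT41 nu ->
  forall x y z t, amul nu (amul nu x (amul nu y z)) t = 0.
Proof.
move: nu; apply: (family_closure_sub (Z := [set nu | forall x y z t,
  amul nu (amul nu x (amul nu y z)) t = 0])).
  do 4![apply: zariski_closed_all => ?]; apply: zariski_closed_vec.
  by repeat first [exact: pmx_const | exact: polymap_id | apply: pmx_amul].
move=> g mu gu [al ->] x y z t; rewrite !amul_gl_act !mulKmx // T41E.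
move: (invmx g *m x) (invmx g *m y) (invmx g *m z) (invmx g *m t) => {}x {}y {}z {}t.
have [? [? [? [? ->]]]] := vec4P x; have [? [? [? [? ->]]]] := vec4P y.
have [? [? [? [? ->]]]] := vec4P z; have [? [? [? [? ->]]]] := vec4P t.
rewrite !amul_tri (_ : vec4 _ _ _ _ = 0) ?mulmx0 // [RHS]vec4_0.
by congr vec4; ring.
Qed.

Lemma closure_T41_mem alpha : ZT41 (T41 alpha).
Proof.
by rewrite -(gl_act1 (T41 _)); apply: family_closure_orbit;
  [exact: unitmx1|exists alpha].
Qed.

Lemma closure_T43_mem lambda alpha : ZT43 (T43 lambda alpha).
Proof.
by rewrite -(gl_act1 (T43 _ _)); apply: family_closure_orbit;
  [exact: unitmx1|exists lambda, alpha].
Qed.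

(** The witness is ((e1e1)e1)e1 = e3e1 = 3e4; the three noninclusions after it also evaluate the
    relevant identity at e1 alone. *)
Lemma T41_not_sub_D01 : ~ ZT41 `<=` ZD.
Proof.
move=> /(_ _ (closure_T41_mem 0))/closure_D01_cube_annihilated.
pose x1 : 'cV[K]_4 := vec4 1 0 0 0; move/(_ x1 x1 x1 x1).
rewrite T41E /x1 !amul_tri vec4_0 => /vec4_inj[_ _ _ E].
by have /eqP : 3 = 0 :> K; [rewrite -[RHS]E; ring|rewrite pnatr_eq0].
Qed.

Lemma T43_not_sub_D01 : ~ ZT43 `<=` ZD.
Proof.
move=> /(_ _ (closure_T43_mem 0 1))/closure_D01_cube_annihilated.
pose x1 : 'cV[K]_4 := vec4 1 0 0 0; move/(_ x1 x1 x1 x1).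
rewrite T43E /x1 !amul_tri vec4_0 => /vec4_inj[_ _ _ E].
by have /eqP : 3 = 0 :> K; [rewrite -[RHS]E; ring|rewrite pnatr_eq0].
Qed.

Lemma T41_not_sub_T43 : ~ ZT41 `<=` ZT43.
Proof.
move=> /(_ _ (closure_T41_mem 0))/closure_T43_square_cube.
pose x1 : 'cV[K]_4 := vec4 1 0 0 0; move/(_ x1 x1 x1 x1 x1).
rewrite T41E /x1 !amul_tri vec4_0 => /vec4_inj[_ _ _ E].
by have /eqP : 1 = 0 :> K; [rewrite -[RHS]E; ring|rewrite oner_eq0].
Qed.

Lemma T43_not_sub_T41 : ~ ZT43 `<=` ZT41.
Proof.
move=> /(_ _ (closure_T43_mem 1 1))/closure_T41_left_cube.
pose x1 : 'cV[K]_4 := vec4 1 0 0 0; move/(_ x1 x1 x1 x1).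
rewrite T43E /x1 !amul_tri vec4_0 => /vec4_inj[_ _ _ E].
by have /eqP : 3 = 0 :> K; [rewrite -[RHS]E; ring|rewrite pnatr_eq0].
Qed.

Lemma has_dimension_sub (I : finType) (Y Z : set (affine K I)) d e :
  has_dimension Y d -> has_dimension Z e -> Y `<=` Z -> (d <= e)%N.
Proof.
move=> [[F [FY Flt]] _] [_ maxZ] YZ; apply: maxZ; exists F; split=> // i id.
by have [clF irrF FiY] := FY i id; split=> // x /FiY/YZ.
Qed.

Lemma D01_not_sub_T41 : ~ ZD `<=` ZT41.
Proof.
by move/(has_dimension_sub (dimension_D01 K) (dimension_T41 K)).
Qed.

Lemma D01_not_sub_T43 : ~ ZD `<=` ZT43.
Proof.
by move/(has_dimension_sub (dimension_D01 K) (dimension_T43 K)).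
Qed.

Lemma irreducible_cover (Y : set (algebra_structure K 4)) :
  irreducible_closed_in (nilpotent_terminal K 4) Y ->
  [\/ Y `<=` ZD, Y `<=` ZT41 | Y `<=` ZT43].
Proof.
move=> [_ [Yne irrY] YN].
have clD := @family_closure_closed K 4 (D01_family K).
have clT41 := @family_closure_closed K 4 (T41_family K).
have clT43 := @family_closure_closed K 4 (T43_family K).
have [|YD|YT] := irrY _ _ clD (zariski_closed_or clT41 clT43).
- by move=> y /YN/nilpotent_terminal_cover[]; [left|right; left|right; right].
- by constructor 1.
have [//|YT41|YT43] := irrY _ _ clT41 clT43.
- by constructor 2.
- by constructor 3.
Qed.

Lemma irreducible_closures :
  [/\ irreducible_closed_in (nilpotent_terminal K 4) ZD,
      irreducible_closed_in (nilpotent_terminal K 4) ZT41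
    & irreducible_closed_in (nilpotent_terminal K 4) ZT43].
Proof.
split; split; try exact: family_closure_closed.
- rewrite closure_D01_param.
  exact: closure_range_irreducible (@polymap_paramD K).
- exact: closure_D01_sub.
- rewrite closure_T41_param.
  exact: closure_range_irreducible (@polymap_param41 K).
- exact: closure_T41_sub.
- rewrite closure_T43_param.
  exact: closure_range_irreducible (@polymap_param43 K).
- exact: closure_T43_sub.
Qed.

Lemma irreducible_components :
  [set Z | irreducible_component (nilpotent_terminal K 4) Z] = [set ZD; ZT41; ZT43].
Proof.
have [irrD irrT41 irrT43] := irreducible_closures.
apply/seteqP; split=> [Z [irrZ maxZ]|Z [[->|->]|->]].
- have [ZD|ZT41|ZT43] := irreducible_cover irrZ.
  + by left; left; rewrite -(maxZ _ irrD).
  + by left; right; rewrite -(maxZ _ irrT41).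
  + by right; rewrite -(maxZ _ irrT43).
- split=> // Y /irreducible_cover[YD|YT|YT] DY.
  + by apply/seteqP.
  + by case: D01_not_sub_T41 => x /DY/YT.
  + by case: D01_not_sub_T43 => x /DY/YT.
- split=> // Y /irreducible_cover[YT|YT|YT] TY.
  + by case: T41_not_sub_D01 => x /TY/YT.
  + by apply/seteqP.
  + by case: T41_not_sub_T43 => x /TY/YT.
- split=> // Y /irreducible_cover[YT|YT|YT] TY.
  + by case: T43_not_sub_D01 => x /TY/YT.
  + by case: T43_not_sub_T41 => x /TY/YT.
  + by apply/seteqP.
Qed.

End Components.

Local Open Scope complex_scope.

Theorem theorem15 (R : realType) :
  let ZD := family_closure (D01_family R[i]) in
  let ZT41 := family_closure (T41_family R[i]) in
  let ZT43 := family_closure (T43_family R[i]) in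
  [/\ [set Z | irreducible_component (nilpotent_terminal R[i] 4) Z]
        = [set ZD; ZT41; ZT43],
      [/\ ZD <> ZT41, ZD <> ZT43 & ZT41 <> ZT43]
    & [/\ has_dimension ZD 17, has_dimension ZT41 15 & has_dimension ZT43 15]].
Proof.
split; first exact: (irreducible_components R[i]).
  split=> E.
  - by apply: (@D01_not_sub_T41 R[i]); rewrite -E.
  - by apply: (@D01_not_sub_T43 R[i]); rewrite -E.
  - by apply: (@T41_not_sub_T43 R[i]); rewrite -E.
split.
- exact: (dimension_D01 R[i]).
- exact: (dimension_T41 R[i]).
- exact: (dimension_T43 R[i]).
Qed.
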